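(* Let $u^{exact}$ be the exact solution, and let $u^{PGD}$ and $u^{FEM}$ be the numerical solutions of PGD (with some number $Q\ge 1$ of modes) and of FEM, respectively. Suppose that PGD and FEM take the same regular mesh, and that FEM takes as shape functions the products of the 1D shape functions of PGD in each dimension. Then $$\| u^{PGD}-u^{exact} \|_E^2 = \| u^{FEM}-u^{exact} \|_E^2 + \| u^{PGD}-u^{FEM} \|_E^2 .$$
   Context: Problem. Let $d\in\{2,3\}$ and let $\Omega\subset\mathbb{R}^d$ be a box (product of $d$ compact intervals). Consider $\mathcal{L}u+b=0$ in $\Omega$, $u|_{\partial\Omega}=0$, for a scalar function $u$, where $\mathcal{L}$ is a second-order differential operator and $b$ a source term. It is assumed that the problem has an energy potential $$\Pi[u]=\tfrac12 a(u,u)-(b,u),\qquad (b,u)=\int_\Omega b\,u\,d\boldsymbol{x},$$ where $a(\cdot,\cdot)$ is the symmetric bilinear form on $H_0^1(\Omega)$ corresponding to $\mathcal{L}$, positive definite so that $\|v\|_E=\sqrt{a(v,v)}$ is a norm (the energy norm). The model case is the Poisson equation $\Delta u+b=0$, with $a(f,g)=\int_\Omega\nabla f\cdot\nabla g\,d\boldsymbol{x}$. The exact solution is $u^{exact}=\arg\min_{u\in H^1_0(\Omega)}\Pi[u]$. Regular mesh and 1D shape functions. A regular mesh is a product of 1D grids, with $n_1,\dots,n_d$ nodes in the coordinate directions, the end nodes being the interval endpoints. In direction $k$ one fixes 1D finite element shape functions $N^{(k)}_1,\dots,N^{(k)}_{n_k}$ attached to the nodes of that direction (continuous, piecewise polynomial,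 equal to $1$ at their own node and $0$ at the other nodes, summing to $1$; e.g. piecewise linear hat functions). FEM. $\mathcal{V}^h$ is the linear span of all products $N^{(1)}_{I_1}(x_1)\cdots N^{(d)}_{I_d}(x_d)$, $1\le I_k\le n_k$, and $\mathcal{V}^h_0$ is the subset of functions in $\mathcal{V}^h$ vanishing on $\partial\Omega$. The FEM solution is $u^{FEM}=\arg\min_{u\in\mathcal{V}^h_0}\Pi[u]$. PGD. $\mathcal{M}^h_Q$ is the set of functions $\sum_{q=1}^Q\prod_{k=1}^d X^{(q)}_k(x_k)$, where each $X^{(q)}_k$ is a real linear combination of $N^{(k)}_1,\dots,N^{(k)}_{n_k}$, and $\mathcal{M}^h_{0,Q}$ is the subset of functions in $\mathcal{M}^h_Q$ vanishing on $\partial\Omega$. A PGD solution with $Q$ modes is a function $u^{PGD}$ obtained either as a minimizer of $\Pi$ over $\mathcal{M}^h_{0,Q}$ (all modes together), or incrementally: $u^{(0)}=0$, $u^{(m)}=u^{(m-1)}+\Delta u^{(m)}$ with $\Delta u^{(m)}\in\arg\min_{\Delta u\in\mathcal{M}^h_{0,1}}\Pi[u^{(m-1)}+\Delta u]$ for $m=1,\dots,Q$, and $u^{PGD}=u^{(Q)}$. *)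

(* Defs.v *)
From HB Require Import structures.
From mathcomp Require Import all_boot all_order all_algebra.
From mathcomp Require Import all_classical all_reals all_analysis.

Set Implicit Arguments.
Unset Strict Implicit.
Unset Printing Implicit Defensive.

Import Order.TTheory GRing.Theory Num.Theory.
Import numFieldNormedType.Exports.

Local Open Scope classical_set_scope.
Local Open Scope ring_scope.

Definition rV_display : measure_display. Proof. by []. Qed.

Section measurable_rV.
Context {R : realType} (n : nat).

Let coord : 'I_n -> 'rV[R]_n -> measurableTypeR R := fun i x => x 0 i.

Let coord_set0 : g_sigma_preimage coord set0.
Proof. exact: sigma_algebra0. Qed.

Let coord_setC A : g_sigma_preimage coord A -> g_sigma_preimage coord (~` A).
Proof. exact: sigma_algebraC. Qed.

Let coord_bigcup (F : _^nat) : (forall i, g_sigma_preimage coord (F i)) ->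
  g_sigma_preimage coord (\bigcup_i (F i)).
Proof. exact: sigma_algebra_bigcup. Qed.

HB.instance Definition _ := @isMeasurable.Build rV_display
  'rV[R]_n (g_sigma_preimage coord) coord_set0 coord_setC coord_bigcup.

End measurable_rV.


Section lebesgue_rV.
Context {R : realType}.
Local Notation mR := (measurableTypeR R).

Definition cons_rV (n : nat) (p : mR * 'rV[R]_n) : 'rV[R]_n.+1 :=
  \row_i (if unlift ord0 i is Some j then p.2 0 j else p.1).

Definition uncons_rV (n : nat) (x : 'rV[R]_n.+1) : mR * 'rV[R]_n :=
  (x 0 ord0, \row_j x 0 (lift ord0 j)).

Lemma cons_rVK n : cancel (@cons_rV n) (@uncons_rV n).
Proof.
move=> [x v]; rewrite /uncons_rV /cons_rV /= mxE unlift_none; congr pair.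
by apply/rowP => j; rewrite !mxE liftK.
Qed.

Lemma measurable_coord n (i : 'I_n) :
  measurable_fun setT (fun x : 'rV[R]_n => x 0 i : mR).
Proof.
move=> _ Y mY; rewrite setTI; apply: sub_sigma_algebra => /=.
rewrite -bigcup_seq/=; exists i => /=; first by rewrite mem_index_enum.
by exists Y => //; rewrite setTI.
Qed.

Lemma measurable_rVP d (T : measurableType d) n (f : T -> 'rV[R]_n) :
  (forall i, measurable_fun setT (fun t => f t 0 i : mR)) ->
  measurable_fun setT f.
Proof.
move=> mf.
pose G := \big[setU/set0]_(i < n)
  preimage_set_system setT (fun x : 'rV[R]_n => x 0 i : mR) measurable.
apply: (@measurability _ _ _ _ setT f G erefl).
move=> _ [B /= + <-]; rewrite /G setTI.
rewrite -bigcup_seq/= => -[i /= _ [A mA <-]].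
rewrite setTI -comp_preimage -[X in measurable X]setTI.
exact: (mf i measurableT).
Qed.

Lemma measurable_cons_rV n : measurable_fun setT (@cons_rV n).
Proof.
apply: measurable_rVP => i; rewrite /cons_rV.
under eq_fun do rewrite mxE.
case: (unliftP ord0 i) => [j _|_]; last exact: measurable_fst.
exact: (measurableT_comp (measurable_coord j) measurable_snd).
Qed.

Lemma measurable_uncons_rV n : measurable_fun setT (@uncons_rV n).
Proof.
apply/measurable_fun_pairP; split; first exact: measurable_coord.
apply: measurable_rVP => i.
by under eq_fun do rewrite /= mxE; exact: measurable_coord.
Qed.

Section step.
Variables (n : nat) (m : {sigma_finite_measure set 'rV[R]_n -> \bar R}).

Definition lebesgue_cons : set 'rV[R]_n.+1 -> \bar R :=
  pushforward (@lebesgue_measure R \x m)%E (@cons_rV n).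

Let lebesgue_cons0 : lebesgue_cons set0 = 0%E.
Proof. by rewrite /lebesgue_cons /pushforward preimage_set0 measure0. Qed.

Let lebesgue_cons_ge0 A : (0 <= lebesgue_cons A)%E.
Proof. by rewrite /lebesgue_cons /pushforward. Qed.

Let lebesgue_cons_sigma_additive : semi_sigma_additive lebesgue_cons.
Proof.
apply: (@measure_semi_sigma_additive _ _ _
  (pushforward (@lebesgue_measure R \x m)%E (@cons_rV n))).
exact: measurable_cons_rV.
Qed.

HB.instance Definition _ := isMeasure.Build _ _ _ lebesgue_cons
  lebesgue_cons0 lebesgue_cons_ge0 lebesgue_cons_sigma_additive.

Let lebesgue_cons_sigma_finite : sigma_finite setT lebesgue_cons.
Proof.
have /sigma_finiteP[F [FT ndF Foo]] := sigma_finiteT (@lebesgue_measure R).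
have /sigma_finiteP[G [GT ndG Goo]] := sigma_finiteT m.
exists (fun k => @uncons_rV n @^-1` (F k `*` G k)).
  apply/esym; rewrite -subTset => x _.
  have [i _ Fi] : (\bigcup_i F i) (uncons_rV x).1 by rewrite -FT.
  have [j _ Gj] : (\bigcup_j G j) (uncons_rV x).2 by rewrite -GT.
  exists (maxn i j) => //; split.
  - by move: Fi; exact/subsetPset/ndF/leq_maxl.
  - by move: Gj; exact/subsetPset/ndG/leq_maxr.
move=> k; have [mF Fook] := Foo k; have [mG Gook] := Goo k; split.
  rewrite -[X in measurable X]setTI; apply: measurable_uncons_rV => //.
  exact: measurableX.
rewrite /lebesgue_cons /pushforward -comp_preimage.
rewrite (_ : _ \o _ = id); last by apply/funext => p; exact: cons_rVK.
by rewrite preimage_id product_measure1E// lte_mul_pinfty// ge0_fin_numE.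
Qed.

HB.instance Definition _ := Measure_isSigmaFinite.Build _ _ _ lebesgue_cons
  lebesgue_cons_sigma_finite.

End step.

(* R^(n+1) is identified with R * R^n through cons_rV; the sigma-finite structure
   is what the product measure requires of its second factor. *)
Fixpoint lebesgue_rV (n : nat)
    : {sigma_finite_measure set 'rV[R]_n -> \bar R} :=
  if n is n'.+1 then lebesgue_cons (lebesgue_rV n')
  else \d_(0 : 'rV[R]_0).

End lebesgue_rV.

Section sobolev.
Context {R : realType} {d : nat}.
Implicit Types (Omega : set 'rV[R]_d) (u v phi b c : 'rV[R]_d -> R)
  (g h : 'rV[R]_d -> 'rV[R]_d).

Local Notation mu := (lebesgue_rV d : {measure set 'rV[R]_d -> \bar R}).

Definition box (lo hi : 'I_d -> R) : set 'rV[R]_d :=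
  [set x | forall k, lo k <= x 0 k <= hi k].

Definition boundary Omega : set 'rV[R]_d := closure Omega `\` Omega°.

Definition partial (i : 'I_d) phi : 'rV[R]_d -> R :=
  fun x => 'D_(delta_mx 0 i) phi x.

Definition smooth phi := forall (s : seq 'I_d),
  continuous (foldr partial phi s) /\
  forall (i : 'I_d) x, derivable (foldr partial phi s) x (delta_mx 0 i).

Definition test_function Omega phi :=
  smooth phi /\
  exists K, [/\ compact K, K `<=` Omega° & forall x, ~ K x -> phi x = 0].

Definition L2 Omega u :=
  measurable_fun Omega u /\ (\int[mu]_(x in Omega) (u x ^+ 2)%:E < +oo)%E.

Definition weak_gradient Omega u g :=
  forall phi, test_function Omega phi -> forall i,
    \int[mu]_(x in Omega) (u x * partial i phi x) =
    - \int[mu]_(x in Omega) (g x 0 i * phi x).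

(* [H1 Omega u g]: u belongs to H^1(Omega), with weak gradient g. *)
Definition H1 Omega u g :=
  [/\ L2 Omega u, forall i, L2 Omega (fun x => g x 0 i) &
      weak_gradient Omega u g].

Definition H1_dist2 Omega u g phi : \bar R :=
  \int[mu]_(x in Omega)
    ((u x - phi x) ^+ 2 + \sum_(i < d) (g x 0 i - partial i phi x) ^+ 2)%:E.

(* H^1_0(Omega): the closure of the test functions in H^1(Omega). *)
Definition H10 Omega u :=
  exists2 g, H1 Omega u g &
    forall eps : R, 0 < eps ->
      exists2 phi, test_function Omega phi &
        (H1_dist2 Omega u g phi < eps%:E)%E.

Definition ae_eq0 Omega u := {ae mu, forall x, Omega x -> u x = 0}.

(* The weak form of -(L u, v), where L is the second-order operator
   L u = sum_ij d_i (A_ij d_j u) + sum_i B_i d_i u + c u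
   (for the Laplacian: A = 1, B = 0, c = 0); g and h are the weak gradients
   of u and v. *)
Definition weak_form_integrand (A : 'rV[R]_d -> 'M[R]_d)
    (B : 'rV[R]_d -> 'rV[R]_d) c u g v h (x : 'rV[R]_d) : R :=
  \sum_(i < d) \sum_(j < d) A x i j * g x 0 j * h x 0 i
  - \sum_(i < d) B x 0 i * g x 0 i * v x - c x * u x * v x.

(* a is the bilinear form on H^1_0(Omega) corresponding to L.  No regularity is
   asked of the coefficients beyond the integral being defined. *)
Definition form_of_operator Omega A B c
    (a : ('rV[R]_d -> R) -> ('rV[R]_d -> R) -> R) :=
  forall u g v h, H10 Omega u -> H1 Omega u g -> H10 Omega v -> H1 Omega v h ->
    mu.-integrable Omega (EFin \o weak_form_integrand A B c u g v h) /\
    a u v = \int[mu]_(x in Omega) weak_form_integrand A B c u g v h x.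

Record symmetric_positive_form Omega
    (a : ('rV[R]_d -> R) -> ('rV[R]_d -> R) -> R) : Prop := {
  form_linear : forall (k : R) u v w,
    H10 Omega u -> H10 Omega v -> H10 Omega w ->
    a (fun x => k * u x + v x) w = k * a u w + a v w;
  form_sym : forall u v, H10 Omega u -> H10 Omega v -> a u v = a v u;
  form_pos : forall u, H10 Omega u -> ~ ae_eq0 Omega u -> 0 < a u u;
}.

(* The pairing (b, v) is defined for every v in H^1_0(Omega); this holds in
   particular for b in L^2(Omega). *)
Definition is_source Omega b :=
  forall v, H10 Omega v -> mu.-integrable Omega (EFin \o (b \* v)).

Definition energy Omega (a : ('rV[R]_d -> R) -> ('rV[R]_d -> R) -> R) b u : R :=
  a u u / 2 - \int[mu]_(x in Omega) (b x * u x).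

Definition energy_norm (a : ('rV[R]_d -> R) -> ('rV[R]_d -> R) -> R) u : R :=
  Num.sqrt (a u u).

Definition is_argmin (S : set ('rV[R]_d -> R)) (F : ('rV[R]_d -> R) -> R) u :=
  S u /\ forall v, S v -> F u <= F v.

End sobolev.

Section discretization.
Context {R : realType}.

Record is_grid (lo hi : R) (n : nat) (t : 'I_n -> R) : Prop := {
  grid_incr : forall i j : 'I_n, (i < j)%N -> t i < t j;
  grid_bounds : forall i, lo <= t i <= hi;
  grid_lo : exists i, t i = lo;
  grid_hi : exists i, t i = hi;
}.

(* Finitely many break points (the sequence s), away from which f is given by
   polynomials; break points need not be grid nodes, nor conversely. *)
Definition piecewise_polynomial (lo hi : R) (f : R -> R) :=
  exists s : seq R, forall y z, lo <= y -> y < z -> z <= hi ->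
    (forall w, w \in s -> ~~ (y < w < z)) ->
    exists p : {poly R}, forall x, y < x < z -> f x = p.[x].

Record is_shape_functions (lo hi : R) (n : nat) (t : 'I_n -> R)
    (N : 'I_n -> R -> R) : Prop := {
  shape_continuous : forall i, {within `[lo, hi], continuous (N i)};
  shape_piecewise : forall i, piecewise_polynomial lo hi (N i);
  shape_node : forall i j, N i (t j) = (i == j)%:R;
  shape_sum : forall x, lo <= x <= hi -> \sum_(i < n) N i x = 1;
}.

Context {d : nat} (Omega : set 'rV[R]_d) (n : 'I_d -> nat)
  (N : forall k : 'I_d, 'I_(n k) -> R -> R).
Implicit Types (u v w : 'rV[R]_d -> R).

(* Functions on Omega are represented by total functions, of which only the
   values on Omega matter. *)
Definition vanishing_on_boundary u := forall x, boundary Omega x -> u x = 0.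

Definition fem_space : set ('rV[R]_d -> R) :=
  [set u | exists c : {dffun forall k : 'I_d, 'I_(n k)} -> R,
    forall x, Omega x -> u x = \sum_I c I * \prod_(k < d) N (I k) (x 0 k)].

Definition fem_space0 : set ('rV[R]_d -> R) :=
  [set u | fem_space u /\ vanishing_on_boundary u].

Definition span1d (k : 'I_d) : set (R -> R) :=
  [set X | exists c : 'I_(n k) -> R,
    forall y, X y = \sum_(i < n k) c i * N i y].

Definition pgd_set (Q : nat) : set ('rV[R]_d -> R) :=
  [set u | exists X : 'I_Q -> 'I_d -> R -> R,
    (forall q k, span1d k (X q k)) /\
    forall x, Omega x -> u x = \sum_(q < Q) \prod_(k < d) X q k (x 0 k)].

Definition pgd_set0 (Q : nat) : set ('rV[R]_d -> R) :=
  [set u | pgd_set Q u /\ vanishing_on_boundary u].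

Definition fem_solution (Pi : ('rV[R]_d -> R) -> R) u :=
  is_argmin fem_space0 Pi u.

Definition pgd_solution_joint (Pi : ('rV[R]_d -> R) -> R) (Q : nat) u :=
  is_argmin (pgd_set0 Q) Pi u.

Definition pgd_solution_incremental (Pi : ('rV[R]_d -> R) -> R) (Q : nat) u :=
  exists w du : nat -> 'rV[R]_d -> R,
    [/\ w 0%N = (fun=> 0),
        forall m, (m < Q)%N ->
          is_argmin (pgd_set0 1) (fun dv => Pi (w m \+ dv)) (du m.+1) /\
          w m.+1 = w m \+ du m.+1 &
        u = w Q].

Definition pgd_solution (Pi : ('rV[R]_d -> R) -> R) (Q : nat) u :=
  pgd_solution_joint Pi Q u \/ pgd_solution_incremental Pi Q u.

End discretization.

(* Main.v *)
(* The PGD solution enters only through its membership in the space V_0 of FEM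
   functions vanishing on the boundary.  Since V_0 is a linear subspace of
   H^1_0, both u_fem and u_exact satisfy the variational identity
   a(u, v) = (b, v) for v in V_0, so a(u_fem - u_exact, v) = 0, and the claim is
   the Pythagorean theorem for v = u_pgd - u_fem.

   That V_0 lies in H^1_0 is seen as follows.  The coefficients of a FEM function
   are its nodal values, so only the nodes inside the box contribute, and it
   suffices to treat products of continuous piecewise polynomials f_k vanishing at
   both ends of [lo_k, hi_k].  Let g be the derivative of f = f_k, set to 0 at the
   break points.  Multiplying g by smooth cutoffs that vanish near the break
   points gives smooth g_n converging boundedly to g; the primitive of g_n,
   corrected by a multiple of the primitive of a fixed bump so as to vanish at
   the right end, is a test function phi_n, with phi_n -> f and phi_n' -> g
   pointwise and boundedly.  Products of these test functions converge in H^1 by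
   dominated convergence, and the integration by parts formula for test functions
   passes to the limit. *)
Require Import Defs.
From HB Require Import structures.
From mathcomp Require Import all_boot all_order all_algebra.
From mathcomp Require Import all_classical all_reals all_analysis.
From mathcomp Require Import measurable_realfun ring lra.
Set Implicit Arguments.
Unset Strict Implicit.
Unset Printing Implicit Defensive.
Import Order.TTheory GRing.Theory Num.Theory.
Import numFieldNormedType.Exports.
Local Open Scope classical_set_scope.
Local Open Scope ring_scope.

(** * Smooth functions on the line *)

Section smooth1.
Context {R : realType}.
Implicit Types (f g : R -> R) (p : {poly R}).

(** Differentiability [n] times; continuity of the last derivative is not part of it, but follows
    once all [n] are required, as in [smooth1]. *)
Fixpoint Ck (n : nat) f : Prop :=
  if n is n'.+1 then (forall x, derivable f x 1) /\ Ck n' (derive1 f) else True.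

Definition smooth1 f := forall n, Ck n f.

Lemma Ck_pred n f : Ck n.+1 f -> Ck n f.
Proof. by elim: n f => // n IH f [df] /IH. Qed.

Lemma Ck_is_derive n f f' :
  (forall x, is_derive (x : R) (1 : R) f (f' x)) -> Ck n f' -> Ck n.+1 f.
Proof.
move=> dff' Cf'; split => [x|]; first exact: ex_derive.
by rewrite (_ : derive1 f = f')//; apply/funext => x; rewrite derive1E derive_val.
Qed.

Lemma Ck_is_derive1 n f : Ck n.+1 f ->
  forall x, is_derive (x : R) (1 : R) f (derive1 f x).
Proof. by move=> [df _] x; rewrite derive1E; exact/derivableP/df. Qed.

Lemma CkD n f g : Ck n f -> Ck n g -> Ck n (f \+ g).
Proof.
elim: n f g => // n IH f g Cf Cg.
apply: (@Ck_is_derive _ _ (derive1 f \+ derive1 g)); last by apply: IH; [case: Cf|case: Cg].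
by move=> x; exact: is_deriveD (Ck_is_derive1 Cf x) (Ck_is_derive1 Cg x).
Qed.

Lemma CkM n f g : Ck n f -> Ck n g -> Ck n (f \* g).
Proof.
elim: n f g => // n IH f g Cf Cg.
apply: (@Ck_is_derive _ _ ((f \* derive1 g) \+ (g \* derive1 f))).
  by move=> x; exact: is_deriveM (Ck_is_derive1 Cf x) (Ck_is_derive1 Cg x).
by apply: CkD; apply: IH; try exact: Ck_pred; [case: Cg|case: Cf].
Qed.

Lemma Ck_horner n p : Ck n (horner p).
Proof. by elim: n p => // n IH p; apply: Ck_is_derive (IH (deriv p)) => x. Qed.

Lemma Ck_cst n k : Ck n (cst k).
Proof.
rewrite (_ : cst k = horner k%:P); first exact: Ck_horner.
by apply/funext => x; rewrite hornerC.
Qed.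

Lemma Ck_comp_horner n f p : Ck n f -> Ck n (f \o horner p).
Proof.
elim: n f => // n IH f Cf.
apply: (@Ck_is_derive n (f \o horner p) (fun x => derive1 f p.[x] * (deriv p).[x])).
  by move=> x; exact: is_derive1_comp (Ck_is_derive1 Cf p.[x]) (is_derive_poly p x).
by apply: (@CkM _ (derive1 f \o horner p) (horner (deriv p)));
  [apply: IH; case: Cf|exact: Ck_horner].
Qed.

(** Meant for functions that are given by different formulas near different points, such as
    [approx_derive]. *)
Lemma Ck_local n f :
  (forall x, exists2 g, Ck n g & \forall y \near (x : R), f y = g y) -> Ck n f.
Proof.
elim: n f => // n IH f floc; split.
  move=> x; have [g [dg _] fg] := floc x.
  apply: (@near_eq_derivable _ _ _ g) => //.
  by near do apply/esym.
apply: IH => x; have [g [dg Cg] fg] := floc x.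
exists (derive1 g) => //; near=> y.
rewrite !derive1E; apply: near_eq_derive => //.
near: y; exact: nbhs_interior fg.
Unshelve. all: by end_near. Qed.

Lemma smooth1_derive1 f : smooth1 f -> smooth1 (derive1 f).
Proof. by move=> Sf n; have [] := Sf n.+1. Qed.

Lemma smooth1_is_derive f : smooth1 f ->
  forall x, is_derive (x : R) (1 : R) f (derive1 f x).
Proof. by move=> /(_ 1%N) /Ck_is_derive1. Qed.

Lemma smooth1_continuous f : smooth1 f -> continuous f.
Proof.
move=> Sf x; apply/differentiable_continuous/derivable1_diffP.
by have [] := Sf 1%N.
Qed.

(** Monomial by monomial: [y ^+ i / i!] is a term of the exponential series. *)
Lemma poly_le_expR p : exists2 C, 0 <= C & forall y, 0 <= y -> `|p.[y]| <= C * expR y.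
Proof.
exists (\sum_(i < size p) `|p`_i| * i`!%:R) => [|y y0].
  by apply: sumr_ge0 => i _; rewrite mulr_ge0.
rewrite horner_coef (le_trans (ler_norm_sum _ _ _))// mulr_suml ler_sum// => i _.
rewrite normrM -mulrA ler_wpM2l// normrX (ger0_norm y0).
rewrite -ler_pdivrMl ?ltr0n ?fact_gt0// mulrC.
case: (i : nat) => [|j]; first by rewrite expr0 fact0 divr1 -(expR0) ler_expR.
by apply: le_trans (expR_ge1Dxn j y0); rewrite lerDr.
Qed.

(** The difference quotient at 0 is at most [C * |h|]. This settles the gluing point of
    [flat_exp]. *)
Lemma is_derive_square_bound f (C : R) : (forall x, `|f x| <= C * x ^+ 2) ->
  is_derive (0 : R) 1 f 0.
Proof.
move=> fC; have f0 : f 0 = 0.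
  by apply/eqP; rewrite -normr_eq0 eq_le normr_ge0 (le_trans (fC _))// expr0n mulr0.
suff : (fun h : R => h^-1 *: (f (h *: 1 + 0) - f 0)) @ 0^' --> (0 : R).
  by move=> cv; apply: DeriveDef; [apply/cvg_ex; exists 0|exact/cvg_lim].
have : (fun h : R => C * `|h|) @ 0^' --> (0 : R).
  rewrite -[X in _ --> X](mulr0 C); apply: cvgMl_tmp.
  rewrite -[X in _ --> X](normr0 R).
  by apply: cvg_norm; exact: cvg_within.
move=> Ch; apply/cvgr0Pnorm_le => e e0.
near=> h; rewrite f0 subr0 addr0 scaler1 normrM normfV.
have h0 : h != 0 by near: h; exact: nbhs_dnbhs_neq.
rewrite ler_pdivrMl ?normr_gt0// (le_trans (fC h))//.
rewrite -real_normK ?num_real// expr2 mulrA [leLHS]mulrC ler_wpM2l//.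
rewrite (le_trans (ler_norm _))//.
by near: h; move/cvgr0Pnorm_le : Ch; apply.
Unshelve. all: by end_near. Qed.

(* The derivative of p(1/x) exp(-1/x) is again of this shape, whence smoothness at 0;
   the bump exp(-1/x) is the case p = 1. *)
Definition flat_exp p (x : R) := if 0 < x then p.[x^-1] * expR (- x^-1) else 0.

Lemma is_derive_flat_exp p x :
  is_derive (x : R) (1 : R) (flat_exp p) (flat_exp ('X^2 * (p - deriv p)) x).
Proof.
have [x0|x0|->] := ltrgt0P x.
- rewrite /flat_exp x0.
  have dV : is_derive (x : R) (1 : R) (fun x : R => x^-1) (- x ^- 2).
    rewrite -[X in is_derive _ _ _ X]mulr1.
    by apply: (@is_deriveV _ id); rewrite gt_eqF.
  have dp : is_derive (x : R) (1 : R) (fun x : R => p.[x^-1]) ((deriv p).[x^-1] * - x ^- 2).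
    exact: is_derive1_comp (is_derive_poly p x^-1) dV.
  have de : is_derive x 1 (fun x : R => expR (- x^-1)) (expR (- x^-1) * x ^- 2).
    have := @is_derive1_comp _ expR (fun x => - x^-1) _ _ _ (is_derive_expR _) (is_deriveN dV).
    by rewrite opprK.
  apply: (@near_eq_is_derive _ _ _ ((fun x => p.[x^-1]) \* (fun x => expR (- x^-1)))).
  + by near=> y; rewrite /flat_exp ifT//; near: y; exact: lt_nbhsr.
  + apply: is_derive_eq; rewrite !hornerE /= /GRing.scale/=; rewrite -!exprVn; ring.
- rewrite [X in is_derive _ _ _ X]/flat_exp ltNge (ltW x0)/=.
  apply: (@near_eq_is_derive _ _ _ (cst 0)).
  by near=> y; rewrite /flat_exp ltNge ltW//; near: y; exact: lt_nbhsl.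
- rewrite [X in is_derive _ _ _ X]/flat_exp ltxx.
  (* With y = 1/x, the bound |p(y)| y^2 <= C exp(y) reads |p(1/x)| exp(-1/x) <= C x^2. *)
  have [C C0 pC] := poly_le_expR (p * 'X^2).
  apply: (@is_derive_square_bound _ C) => x'; rewrite /flat_exp.
  case: ifPn => x0'; last by rewrite normr0 mulr_ge0// sqr_ge0.
  have xV : 0 < x'^-1 by rewrite invr_gt0.
  have := pC _ (ltW xV).
  rewrite hornerM hornerXn normrM normrX (ger0_norm (ltW xV)).
  rewrite exprVn ler_pdivrMr ?exprn_gt0// => H.
  rewrite normrM (ger0_norm (expR_ge0 _)) expRN ler_pdivrMr ?expR_gt0//.
  by rewrite (le_trans H)// mulrAC.
Unshelve. all: by end_near. Qed.

Lemma smooth1_flat_exp p : smooth1 (flat_exp p).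
Proof. by move=> n; elim: n p => // n IH p; apply: Ck_is_derive (is_derive_flat_exp p) (IH _). Qed.

Definition bump (x : R) := flat_exp 1 x.

Lemma bump_gt0 x : 0 < x -> 0 < bump x.
Proof. by move=> x0; rewrite /bump /flat_exp x0 hornerC mul1r expR_gt0. Qed.

Lemma bump_le0 x : x <= 0 -> bump x = 0.
Proof. by move=> x0; rewrite /bump /flat_exp ltNge x0. Qed.

Lemma bump_ge0 x : 0 <= bump x.
Proof. by have [/bump_le0->|/bump_gt0/ltW] := leP x 0. Qed.

Lemma bump_le1 x : bump x <= 1.
Proof.
have [/bump_le0->//|x0] := leP x 0.
by rewrite /bump /flat_exp x0 hornerC mul1r expR_le1// oppr_le0 invr_ge0 ltW.
Qed.

Lemma bump_cvgy : bump x @[x --> +oo] --> (1 : R).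
Proof.
rewrite -[X in _ --> X]expR0 -oppr0.
have e : \forall x \near +oo, expR (- x^-1) = bump x.
  apply: filterS (nbhs_pinfty_gt (num_real (0 : R))) => x x0.
  by rewrite /bump /flat_exp x0 hornerC mul1r.
apply: cvg_trans (near_eq_cvg e) _.
apply: continuous_cvg; first exact: continuous_expR.
apply: cvgN; apply/gtr0_cvgV0; last exact: cvg_id.
exact: nbhs_pinfty_gt (num_real (0 : R)).
Qed.

End smooth1.

(** * Primitives *)

(** Dominated convergence with the constant [M] as dominating function, integrable because [D] has
    finite measure. *)
Lemma bounded_cvg_Rintegral (d : measure_display) (T : measurableType d)
    (R : realType) (mu : {measure set T -> \bar R}) (D : set T)
    (f_ : (T -> R)^nat) (f : T -> R) (M : R) :
  measurable D -> (mu D < +oo)%E ->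
  (forall n, measurable_fun D (f_ n)) ->
  (forall n x, D x -> `|f_ n x| <= M) ->
  (forall x, D x -> f_ ^~ x @ \oo --> f x) ->
  \int[mu]_(x in D) f_ n x @[n --> \oo] --> \int[mu]_(x in D) f x.
Proof.
move=> mD Dfin mf_ f_M f_f.
have mf : measurable_fun D f by exact: measurable_fun_cvg mf_ f_f.
have iM : mu.-integrable D (EFin \o cst M).
  by apply: measurable_bounded_integrable => //; exact: bounded_cst.
have [|||||iF _ H] := @dominated_convergence _ T R mu D mD (fun n => EFin \o f_ n) (EFin \o f)
  (EFin \o cst M).
- by move=> n; exact/measurable_EFinP.
- exact/measurable_EFinP.
- by apply: aeW => x Dx /=; apply: cvg_EFin (f_f _ Dx); exact: nearW.
- by [].
- by apply: aeW => x n Dx /=; rewrite lee_fin f_M.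
move: H; rewrite -(fineK (integrable_fin_num mD iF)).
exact: fine_cvg.
Qed.

Lemma compact_bound (R : realType) (T : topologicalType) (K : set T) (f : T -> R) :
  compact K -> continuous f -> exists M, forall x, K x -> `|f x| <= M.
Proof.
move=> cK cf.
have /compact_bounded[M [_ HM]] : compact (f @` K).
  by apply: continuous_compact cK; exact: continuous_subspaceT.
exists (M + 1) => x Kx; apply: HM; first by rewrite ltrDl.
by exists x.
Qed.

Section primitive.
Context {R : realType}.
Local Notation mu := (@lebesgue_measure R).

(** The fundamental theorem covers only points to the right of [a]. Since [h] vanishes before
    [b > a], the primitive is locally 0 at every point before [b], which gives the derivative on the
    whole line. *)
Lemma primitive_exists (h : R -> R) (a b : R) : a < b -> continuous h ->
  (forall x, x < b -> h x = 0) ->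
  let H x := \int[mu]_(t in `[a, x]) h t in
  forall x, is_derive (x : R) (1 : R) H (h x).
Proof.
move=> ab ch h0 H x.
have intH u : mu.-integrable `[a, u] (EFin \o h).
  apply: continuous_compact_integrable; first exact: segment_compact.
  exact: continuous_subspaceT.
have [xb|bx] := ltP x b.
  rewrite h0//; apply: (@near_eq_is_derive _ _ _ (cst 0)).
  apply: filterS (lt_nbhsl xb) => y yb; apply/esym.
  transitivity (\int[mu]_(t in `[a, y]) (0 : R)); last by rewrite Rintegral_cst// mul0r.
  apply: eq_Rintegral => t; rewrite inE/= in_itv/= => /andP[_ ty].
  by rewrite h0// (le_lt_trans ty).
have x1 : x < x + 1 by rewrite ltrDl.
have [dH eH] := continuous_FTC1_closed x1 (intH _) (lt_le_trans ab bx) (ch x).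
by apply: DeriveDef; [exact: dH|rewrite -derive1E; exact: eH].
Qed.

Lemma is_derive_continuous (F f : R -> R) :
  (forall x, is_derive (x : R) (1 : R) F (f x)) -> continuous F.
Proof.
move=> dF x; apply/differentiable_continuous/derivable1_diffP.
exact: ex_derive.
Qed.

Lemma derive0_const_ge (F f : R -> R) (b : R) :
  (forall x, is_derive (x : R) (1 : R) F (f x)) -> (forall x, b <= x -> f x = 0) ->
  forall x, b <= x -> F x = F b.
Proof.
move=> dF f0 x bx.
have cF := continuous_subspaceT (is_derive_continuous dF).
have [c /itvP cb] := MVT_segment bx (fun y _ => dF y) (cF _).
by rewrite f0 ?cb// mul0r => /subr0_eq.
Qed.

Lemma derive_bound_segment (F f : R -> R) (a b M : R) : 0 <= M ->
  (forall x, is_derive (x : R) (1 : R) F (f x)) -> F a = 0 ->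
  (forall x, a <= x <= b -> `|f x| <= M) ->
  forall x, a <= x <= b -> `|F x| <= M * (b - a).
Proof.
move=> M0 dF Fa fM x /andP[ax xb].
have cF := continuous_subspaceT (is_derive_continuous dF).
have [c /itvP cb] := MVT_segment ax (fun y _ => dF y) (cF _).
rewrite Fa subr0 => ->; rewrite normrM ler_pM//.
  by rewrite fM// cb (le_trans _ xb)// cb.
by rewrite ger0_norm ?subr_ge0// lerD2r.
Qed.

(** Serves both for the fixed bump [rho] and for the smoothed derivatives in [smooth_approx]: each
    primitive is 0 on the left and constant on the right. *)
Lemma bump_primitive (h : R -> R) (a b c : R) : a < b -> continuous h ->
  (forall x, ~~ (b < x < c) -> h x = 0) ->
  let H x := \int[mu]_(t in `[a, x]) h t in
  [/\ forall x, is_derive (x : R) (1 : R) H (h x),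
      forall x, x <= b -> H x = 0 & forall x, c <= x -> H x = H c].
Proof.
move=> ab ch h0 H.
have dH x : is_derive (x : R) (1 : R) H (h x).
  by apply: (primitive_exists ab) => // y yb; rewrite h0// negb_and -leNgt ltW.
have Ha : H a = 0 by rewrite /H set_itv1 Rintegral_set1.
split => // x; last first.
  by apply: derive0_const_ge dH _ _ => y cy; rewrite h0// negb_and -!leNgt cy orbT.
move=> xb; have [xa|ax] := ltP x a.
  by rewrite /H set_itv_ge ?Rintegral_set0// bnd_simp -ltNge.
(* Between [a] and [b] the derivative is 0, so the mean value bound applies with constant 0. *)
apply/eqP; rewrite -normr_le0 -(mul0r (b - a)).
apply: (derive_bound_segment _ dH) => //; last by rewrite ax.
by move=> y /andP[_ yb]; rewrite h0 ?normr0// negb_and -leNgt yb.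
Qed.

End primitive.

(** * Smooth approximation of continuous piecewise polynomials *)

Section approx1.
Context {R : realType}.
Variables (lo hi : R) (f : R -> R) (s : seq R).
Hypothesis lo_lt_hi : lo < hi.
Hypothesis f_cont : {within `[lo, hi], continuous f}.
Hypothesis f_poly : forall y z, lo <= y -> y < z -> z <= hi ->
  (forall w, w \in s -> ~~ (y < w < z)) ->
  exists p : {poly R}, forall x, y < x < z -> f x = p.[x].
Hypothesis f_lo : f lo = 0.
Hypothesis f_hi : f hi = 0.
Local Notation mu := (@lebesgue_measure R).

(** The end points and the break points of [f], not the nodes of a grid: [pw_derive] is 0 there by
    convention, as it is outside the segment. *)
Let nodes := lo :: hi :: s.
Let off (x : R) := (lo < x < hi) && (x \notin s).

Definition pw_derive (x : R) : R := if off x then derive1 f x else 0.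
Local Notation g := pw_derive.

(** For n > 0 the factor of [w] vanishes exactly within distance 1/n of [w]; elsewhere its argument
    tends to infinity with n, where [bump] tends to 1. *)
Definition cutoff (r : seq R) (n : nat) (x : R) :=
  \prod_(w <- r) bump (n%:R ^+ 2 * (x - w) ^+ 2 - 1).

Lemma seq_gap (r : seq R) x :
  exists2 delta, 0 < delta & forall w, w \in r -> w = x \/ delta <= `|w - x|.
Proof.
elim: r => [|w r [delta d0 IH]]; first by exists 1.
have [->|wx] := eqVneq w x.
  by exists delta => // v; rewrite inE => /predU1P[->|/IH//]; left.
exists (Num.min delta `|w - x|); first by rewrite lt_min d0 normr_gt0 subr_eq0.
move=> v; rewrite inE => /predU1P[->|/IH[->|dv]]; [right|left|right] => //.
  by rewrite ge_min lexx orbT.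
by rewrite ge_min dv.
Qed.

(** A radius below the distance from [x] to every point of [nodes] gives an interval inside the
    segment and free of break points. *)
Lemma off_local x : off x -> exists2 delta, 0 < delta &
  exists p : {poly R}, forall y, `|y - x| < delta -> off y /\ f y = p.[y].
Proof.
move=> /andP[/andP[lox xhi] xs].
have [delta d0 gap] := seq_gap nodes x.
have lod : lo <= x - delta.
  have [|e|] := gap lo; first by rewrite !inE eqxx.
    by move: lox; rewrite e ltxx.
  by rewrite ltr0_norm ?subr_lt0//; lra.
have hid : x + delta <= hi.
  have [|e|] := gap hi; first by rewrite !inE eqxx orbT.
    by move: xhi; rewrite e ltxx.
  by rewrite gtr0_norm ?subr_gt0//; lra.
have gs w : w \in s -> ~~ (x - delta < w < x + delta).
  move=> ws; have [|e|] := gap w; first by rewrite !inE ws !orbT.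
    by rewrite -e ws in xs.
  by apply: contraTN; rewrite -ltNge -ltr_distl.
have [|p fp] := f_poly lod _ hid gs; first by rewrite ltrD2l; lra.
exists delta => //; exists p => y yx.
have yd : x - delta < y < x + delta by rewrite -ltr_distl.
split; last exact: fp.
have /andP[y1 y2] := yd.
rewrite /off (le_lt_trans lod y1) (lt_le_trans y2 hid)/=.
by apply/negP => /gs; rewrite yd.
Qed.

Lemma pw_derive_local x : off x -> exists2 delta, 0 < delta &
  exists p : {poly R}, forall y, `|y - x| < delta ->
    [/\ off y, f y = p.[y] & g y = (deriv p).[y]].
Proof.
move=> /off_local[delta d0 [p fp]]; exists delta => //; exists p => y yx.
have [offy fy] := fp _ yx; split => //.
rewrite /g offy derivE !derive1E; apply: near_eq_derive.
have /(@nbhsx_ballx _ R^o y): 0 < delta - `|y - x| by rewrite subr_gt0.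
apply: filterS => z yz; apply: (fp _ _).2.
rewrite -[z](subrK y) -addrA (le_lt_trans (ler_normD _ _))//.
by move: yz; rewrite /ball/= distrC ltrBrDr.
Qed.

Lemma pw_derive_notin x : x \in nodes -> g x = 0.
Proof.
rewrite /g /off !inE => /or3P[/eqP->|/eqP->|->]; rewrite ?ltxx ?andbF//.
Qed.

Lemma smooth1_cutoff r n : smooth1 (cutoff r n).
Proof.
move=> k; rewrite /cutoff; elim: r => [|w r IH].
  by under eq_fun do rewrite big_nil; exact: Ck_cst.
under eq_fun do rewrite big_cons.
apply: (@CkM _ k (fun x => bump (n%:R ^+ 2 * (x - w) ^+ 2 - 1)) _ _ IH).
pose q : {poly R} := (n%:R ^+ 2)%:P * ('X - w%:P) ^+ 2 - 1.
rewrite (_ : (fun x => _) = bump \o horner q).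
  by apply: Ck_comp_horner; exact: smooth1_flat_exp.
by apply/funext => x; rewrite /= /q !hornerE.
Qed.

Lemma cutoff_ge0 r n x : 0 <= cutoff r n x.
Proof. by apply: prodr_ge0 => w _; exact: bump_ge0. Qed.

Lemma cutoff_le1 r n x : cutoff r n x <= 1.
Proof.
have <- : \prod_(w <- r) (1 : R) = 1 by rewrite big1_eq.
by apply: ler_prod => w _; rewrite bump_ge0 bump_le1.
Qed.

Lemma cutoff_eq0 r n x w : w \in r -> `|x - w| <= n.+1%:R^-1 ->
  cutoff r n.+1 x = 0.
Proof.
move=> wr xw; apply/eqP; rewrite /cutoff prodf_seq_eq0; apply/hasP; exists w => //=.
apply/eqP/bump_le0; rewrite subr_le0 -exprMn -real_normK ?num_real// expr_le1//.
by rewrite normrM ger0_norm// -ler_pdivlMl// mulr1.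
Qed.

Lemma cutoff_cvg (r : seq R) (x : R) : x \notin r -> cutoff r n x @[n --> \oo] --> (1 : R).
Proof.
elim: r => [_|w r IH].
  by rewrite /cutoff; under eq_fun do rewrite big_nil; exact: cvg_cst.
rewrite inE negb_or => /andP[xw /IH {}IH].
suff qy : n%:R ^+ 2 * (x - w) ^+ 2 - 1 @[n --> \oo] --> +oo.
  have := cvgM (cvg_comp _ _ qy bump_cvgy) IH; rewrite mulr1.
  rewrite (_ : (fun n => cutoff (w :: r) n x) =
    (fun n => bump (n%:R ^+ 2 * (x - w) ^+ 2 - 1) * cutoff r n x)).
    exact.
  by apply/funext => n; rewrite /cutoff big_cons.
have xw2 : 0 < (x - w) ^+ 2 by rewrite exprn_even_gt0//= subr_eq0.
apply/cvgryPge => A.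
near=> n; rewrite lerBrDr -ler_pdivrMr//.
have n1 : 1 <= n%:R :> R by rewrite (_ : 1 = 1%:R)// ler_nat; near: n; exact: nbhs_infty_ge.
rewrite (@le_trans _ _ n%:R)//; first by near: n; exact: nbhs_infty_ger.
by rewrite expr2 ler_peMr// (le_trans ler01).
Unshelve. all: by end_near. Qed.

Definition approx_derive n (x : R) := g x * cutoff nodes n.+1 x.
Local Notation p := approx_derive.

(** Three kinds of points: off the nodes and inside the segment, a polynomial times a cutoff; at a
    node, the cutoff is 0 nearby; outside the segment, [g] is 0 nearby. *)
Lemma smooth1_approx_derive n : smooth1 (p n).
Proof.
move=> k; apply: Ck_local => x.
have [xoff|xoff] := boolP (off x).
  have [delta d0 [q gq]] := pw_derive_local xoff.
  exists (horner (deriv q) \* cutoff nodes n.+1).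
    by apply: CkM; [exact: Ck_horner|exact: smooth1_cutoff].
  have /(@nbhsx_ballx _ R^o x) := d0; apply: filterS => y.
  by rewrite /ball/= distrC => /gq[_ _]; rewrite /p => ->.
exists (cst 0); first exact: Ck_cst.
have [xn|] := boolP (x \in nodes).
  have /(@nbhsx_ballx _ R^o x) : 0 < n.+1%:R^-1 :> R by [].
  apply: filterS => y; rewrite /ball/= distrC => /ltW xy.
  by rewrite /p (cutoff_eq0 xn xy) mulr0.
rewrite !inE !negb_or => /and3P[xlo xhi xs].
move: xoff; rewrite /off xs andbT negb_and -!leNgt.
rewrite !le_eqVlt (negPf xlo) eq_sym (negPf xhi)/= => /orP[xl|xh].
  apply: filterS (lt_nbhsl xl) => y yl.
  by rewrite /p /g /off (ltNge lo) (ltW yl)/= mul0r.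
apply: filterS (lt_nbhsr xh) => y yl.
by rewrite /p /g /off (ltNge y) (ltW yl)/= andbF mul0r.
Qed.

Lemma approx_derive_cvg x : p n x @[n --> \oo] --> g x.
Proof.
(* At a node the whole sequence is 0, so the limit is right only because [pw_derive] has the default
   value 0 there. *)
have [xn|xn] := boolP (x \in nodes).
  by rewrite /p pw_derive_notin//; under eq_fun do rewrite mul0r; exact: cvg_cst.
rewrite -[X in _ --> X]mulr1; apply: cvgMl_tmp.
by have := cutoff_cvg xn; rewrite -(cvg_shiftS (fun n => cutoff _ n x)).
Qed.

Lemma normr_approx_derive n x : `|p n x| <= `|g x|.
Proof. by rewrite normrM ler_piMr// ger0_norm ?cutoff_ge0// cutoff_le1. Qed.

Lemma approx_derive_supp n x :
  ~~ (lo + n.+1%:R^-1 < x < hi - n.+1%:R^-1) -> p n x = 0.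
Proof.
have n0 : 0 < n.+1%:R^-1 :> R by [].
have [xn|xn] := boolP (x \in nodes); first by rewrite /p pw_derive_notin// mul0r.
have [|xoff] := boolP (off x); last by rewrite /p /g (negPf xoff) mul0r.
move=> /andP[/andP[lox xhi] _].
rewrite negb_and -!leNgt => /orP[xl|xh].
  rewrite /p (@cutoff_eq0 _ _ _ lo) ?mulr0 ?inE ?eqxx//.
  by rewrite gtr0_norm ?subr_gt0// lerBlDl.
rewrite /p (@cutoff_eq0 _ _ _ hi) ?mulr0 ?inE ?eqxx ?orbT//.
by rewrite ltr0_norm ?subr_lt0// opprB lerBlDl -lerBlDr.
Qed.

(** A pointwise limit of continuous functions. *)
Lemma pw_derive_measurable : measurable_fun setT g.
Proof.
apply: (@measurable_fun_cvg _ _ _ _ p) => [n|x _]; last exact: approx_derive_cvg.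
by apply: continuous_measurable_fun; apply: smooth1_continuous (smooth1_approx_derive _).
Qed.

Lemma count_lt (T : eqType) (a b : pred T) (r : seq T) :
  subpred a b -> has (predD b a) r -> (count a r < count b r)%N.
Proof.
move=> ab; elim: r => //= x r IH /orP[/andP[/= nax ->]|/IH lt].
  by rewrite (negPf nax) add0n add1n ltnS sub_count.
by rewrite -addnS leq_add//; have := ab x; case: (a x) => // /(_ isT) ->.
Qed.

(** Induction on the number of break points strictly inside the interval: splitting at one of them
    removes it from the interior of both halves. *)
Lemma breakpoint_ind (P : R -> R -> Prop) :
  (forall y z, lo <= y -> y < z -> z <= hi ->
     (forall w, w \in s -> ~~ (y < w < z)) -> P y z) ->
  (forall y w z, lo <= y -> y < w -> w < z -> z <= hi -> P y w -> P w z -> P y z) ->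
  forall y z, lo <= y -> y < z -> z <= hi -> P y z.
Proof.
move=> Pbase Psplit y z.
have [m] := ubnP (count (fun w => y < w < z) s).
elim: m y z => // m IH y z ltm loy yz zhi.
have [/hasP[w ws /andP[yw wz]]|/hasPn ns] := boolP (has (fun w => y < w < z) s);
  last exact: Pbase.
(* Common to both halves: a subinterval without [w] in its interior has strictly fewer inner break
   points. *)
suff lt_count y' z' : y <= y' -> z' <= z -> (w <= y') || (z' <= w) ->
    (count (fun v => (y' < v < z')%R) s < m)%N.
  apply: (Psplit _ w) => //.
  - apply: IH => //; last exact: le_trans (ltW wz) zhi.
    by apply: lt_count; rewrite ?lexx ?orbT//; exact: ltW.
  - apply: IH => //; last exact: le_trans loy (ltW yw).
    by apply: lt_count; rewrite ?lexx ?orbT//; exact: ltW.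
move=> yy' zz' wy'; rewrite -ltnS; apply: leq_trans ltm; rewrite ltnS.
apply: count_lt => [v /andP[y'v vz']|].
  by rewrite (le_lt_trans yy') ?(lt_le_trans vz').
apply/hasP; exists w => //=; rewrite yw wz andbT negb_and -!leNgt.
by rewrite wy'.
Qed.

Lemma pw_derive_poly y z : lo <= y -> y < z -> z <= hi ->
  (forall w, w \in s -> ~~ (y < w < z)) ->
  exists q : {poly R}, forall x, y < x < z ->
    derivable f x 1 /\ derive1 f x = q.[x] /\ g x = q.[x].
Proof.
move=> loy yz zhi ns; have [q fq] := f_poly loy yz zhi ns.
exists (deriv q) => x /[dup] yxz /andP[yx xz].
have fqx : {near (x : R), f =1 horner q}.
  near=> t; apply: fq; apply/andP; split; near: t; [exact: lt_nbhsr|exact: lt_nbhsl].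
have dfx : derive1 f x = (deriv q).[x].
  by rewrite derivE !derive1E; apply: near_eq_derive.
split; last split => //.
  apply: (@near_eq_derivable _ _ _ (horner q)); last exact: derivable_horner.
  by near do apply/esym.
rewrite /g ifT// /off (le_lt_trans loy yx) (lt_le_trans xz zhi)/=.
by apply/negP => /ns; rewrite yxz.
Unshelve. all: by end_near. Qed.

Lemma pw_derive_bound : exists2 M, 0 <= M & forall x, `|g x| <= M.
Proof.
suff [M HM] : exists M, forall x, lo <= x <= hi -> `|g x| <= M.
  exists (Num.max M 0); first by rewrite le_max lexx orbT.
  move=> x; rewrite le_max; have [xlh|xlh] := boolP (lo <= x <= hi); first by rewrite HM.
  rewrite /g ifF ?normr0 ?lexx ?orbT//; apply: contraNF xlh.
  by move=> /andP[/andP[/ltW -> /ltW ->]].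
apply: (@breakpoint_ind (fun y z => exists M, forall x, y <= x <= z -> `|g x| <= M)) => //.
  move=> y z loy yz zhi /(pw_derive_poly loy yz zhi)[q gq].
  have [M HM] := compact_bound (@segment_compact _ y z) (@continuous_horner _ q).
  (* The polynomial describes [g] only strictly inside, so the values at the end points enter the
     bound separately. *)
  exists (Num.max M (Num.max `|g y| `|g z|)) => x /andP[].
  rewrite !le_max le_eqVlt => /predU1P[->|yx]; first by rewrite lexx orbT.
  rewrite le_eqVlt => /predU1P[->|xz]; first by rewrite lexx !orbT.
  have /gq[_ [_ ->]] : y < x < z by rewrite yx.
  by rewrite HM//= in_itv/= !ltW.
move=> y w z _ _ _ _ [M HM] [N HN]; exists (Num.max M N) => x /andP[yx xz].
rewrite le_max; have [xw|wx] := leP x w; first by rewrite HM ?yx.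
by rewrite HN ?orbT// xz ltW.
Qed.

Lemma pw_derive_integrable y z : mu.-integrable `[y, z] (EFin \o g).
Proof.
have [M M0 gM] := pw_derive_bound.
apply: measurable_bounded_integrable => //.
- by apply: compact_finite_measure; exact: segment_compact.
- exact: measurable_funS pw_derive_measurable.
- by exists M; split=> [|N MN x _]; [exact: num_real|rewrite /= (le_trans (gM x))// ltW].
Qed.

(** Between break points this is the fundamental theorem for a polynomial; continuity of [f] up to
    the end points rules out jumps, so the increments add up across break points. *)
Lemma pw_derive_FTC y z : lo <= y -> y < z -> z <= hi ->
  \int[mu]_(x in `[y, z]) g x = f z - f y.
Proof.
apply: (@breakpoint_ind (fun y z => \int[mu]_(x in `[y, z]) g x = f z - f y)); last first.
  move=> {}y w {}z loy yw wz zhi Iyw Iwz.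
  have := @Rintegral_itvB _ g (BLeft y) (BRight z) w (pw_derive_integrable y z).
  rewrite !bnd_simp => /(_ (ltW yw) (ltW wz)).
  rewrite Rintegral_itv_obnd_cbnd; last first.
    by apply: integrableS (pw_derive_integrable w z) => //; exact: subset_itv_oc_cc.
  by rewrite Iyw Iwz => /(canRL (subrK _)) ->; ring.
move=> {}y {}z loy yz zhi /(pw_derive_poly loy yz zhi)[q gq].
have fyz : {within `[y, z], continuous f}.
  by apply: continuous_subspaceW f_cont; apply: subset_itvScc; rewrite bnd_simp.
have [_ fy fz] := (continuous_within_itvP _ yz).1 fyz.
(* The end points are negligible, so [g] may be replaced by the polynomial that it equals inside. *)
transitivity (\int[mu]_(x in `[y, z]) q.[x]).
  have oo h : mu.-integrable `[y, z] (EFin \o h) ->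
      \int[mu]_(x in `]y, z[) h x = \int[mu]_(x in `[y, z]) h x.
    move=> ih; rewrite Rintegral_itv_bndo_bndc ?Rintegral_itv_obnd_cbnd//.
      by apply: integrableS ih => //; exact: subset_itv_oc_cc.
    by apply: integrableS ih => //; exact: subset_itv_oo_cc.
  rewrite -(oo g (pw_derive_integrable y z)) -(oo (horner q)); last first.
    by apply: continuous_compact_integrable; [exact: segment_compact|
      exact/continuous_subspaceT/continuous_horner].
  by apply: eq_Rintegral => x; rewrite inE/= in_itv/= => /gq[_ []].
rewrite /Rintegral (@continuous_FTC2 _ (horner q) f)//.
- exact/continuous_subspaceT/continuous_horner.
- by split => // x; rewrite in_itv/= => /gq[].
- by move=> x; rewrite in_itv/= => /gq[_ []].
Qed.

Lemma smooth_approx : exists (phi : nat -> R -> R) (C : R),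
  [/\ forall n, smooth1 (phi n),
      forall n, exists2 delta, 0 < delta &
        forall x, ~~ (lo + delta <= x <= hi - delta) -> phi n x = 0,
      forall n x, `|phi n x| <= C /\ `|derive1 (phi n) x| <= C &
      forall x, lo <= x <= hi ->
        phi n x @[n --> \oo] --> f x /\
        derive1 (phi n) x @[n --> \oo] --> g x].
Proof.
have [M M0 gM] := pw_derive_bound.
(* A margin at each end that leaves the middle half of the segment for the fixed bump [rho]. *)
have [e e0 lohi] : exists2 e, 0 < e & lo + e < hi - e.
  have lh := lo_lt_hi; exists ((hi - lo) / 4); first by rewrite divr_gt0// subr_gt0.
  by lra.
pose rho x := bump ((x - (lo + e)) * ((hi - e) - x)).
have rho_out x : ~~ (lo + e < x < hi - e) -> rho x = 0.
  move=> xout; apply: bump_le0; move: xout; rewrite negb_and -!leNgt => /orP[xl|xh].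
    by rewrite mulr_le0_ge0// ?subr_le0// subr_ge0 (le_trans xl)// ltW.
  by rewrite mulr_ge0_le0// ?subr_le0// subr_ge0 (le_trans _ xh)// ltW.
have rho1 x : `|rho x| <= 1 by rewrite ger0_norm ?bump_ge0// bump_le1.
have Srho : smooth1 rho.
  move=> k; pose q : {poly R} := ('X - (lo + e)%:P) * ((hi - e)%:P - 'X).
  rewrite (_ : rho = bump \o horner q).
    by apply: Ck_comp_horner; exact: smooth1_flat_exp.
  by apply/funext => x; rewrite /= /q !hornerE.
pose F x := \int[mu]_(t in `[lo, x]) rho t.
have lo_e : lo < lo + e by rewrite ltrDl.
have [dF F_lo F_hi] : [/\ forall x, is_derive (x : R) (1 : R) F (rho x),
    forall x, x <= lo + e -> F x = 0 & forall x, hi - e <= x -> F x = F (hi - e)].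
  exact: bump_primitive lo_e (smooth1_continuous Srho) rho_out.
(* By the mean value theorem, [F] grows over the middle half by its length times a value of [rho] at
   an inner point, which is positive. *)
have Fhi0 : 0 < F hi.
  rewrite F_hi; last by lra.
  have [c /itvP cb Fc] := MVT lohi (fun y _ => dF y)
    (continuous_subspaceT (is_derive_continuous dF)).
  have -> : F (hi - e) = rho c * (hi - e - (lo + e)).
    by rewrite -Fc (F_lo (lo + e))// subr0.
  rewrite mulr_gt0 ?subr_gt0//.
  by apply: bump_gt0; rewrite mulr_gt0// subr_gt0 cb.
have F_hi' x : hi - e <= x -> F x = F hi.
  by move=> xe; rewrite [RHS]F_hi ?F_hi//; lra.
pose P n x := \int[mu]_(t in `[lo, x]) p n t.
have lo_n n : lo < lo + n.+1%:R^-1 by rewrite ltrDl.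
have PE n : [/\ forall x, is_derive (x : R) (1 : R) (P n) (p n x),
    forall x, x <= lo + n.+1%:R^-1 -> P n x = 0 &
    forall x, hi - n.+1%:R^-1 <= x -> P n x = P n (hi - n.+1%:R^-1)].
  exact: bump_primitive (lo_n n) (smooth1_continuous (smooth1_approx_derive n))
    (@approx_derive_supp n).
have dP n : forall x, is_derive (x : R) (1 : R) (P n) (p n x) by have [] := PE n.
have P_lo n x : x <= lo + n.+1%:R^-1 -> P n x = 0 by have [_ + _] := PE n; exact.
have P_hi n x : hi - n.+1%:R^-1 <= x -> P n x = P n hi.
  have [_ _ Phi] := PE n => xn; rewrite [LHS]Phi// [RHS]Phi//.
  by rewrite gerBl.
have pM n x : `|p n x| <= M by apply: le_trans (normr_approx_derive _ _) (gM _).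
pose L := hi - lo.
have L0 : 0 < L by rewrite subr_gt0.
have PM n x : lo <= x <= hi -> `|P n x| <= M * L.
  by apply: (derive_bound_segment M0 (dP n)) => //; rewrite P_lo// ltW.
(* The multiple of [F] that cancels [P n] at [hi]. It tends to 0, because [P n hi] tends to
   [f hi = 0], so the correction disappears in the limit. *)
pose k n := P n hi / F hi.
pose phi n x := P n x - k n * F x.
pose psi n x := p n x - k n * rho x.
have dphi n x : is_derive (x : R) (1 : R) (phi n) (psi n x).
  exact: is_deriveB (dP n x) (is_deriveZ (k n) (dF x)).
have phi' n : derive1 (phi n) = psi n.
  by apply/funext => x; rewrite derive1E derive_val.
(* [F] is constant within [e] of each end and [P n] within 1/(n+1); on the smaller margin both
   are. *)
pose dl n := Num.min e n.+1%:R^-1.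
have dl0 n : 0 < dl n by rewrite lt_min e0 /= invr_gt0 ltr0n.
have phi_out n x : ~~ (lo + dl n <= x <= hi - dl n) -> phi n x = 0.
  have de : dl n <= e by rewrite ge_min lexx.
  have dn : dl n <= n.+1%:R^-1 by rewrite ge_min lexx orbT.
  rewrite negb_and -!ltNge /phi => /orP[xl|xh].
    have x1 : x <= lo + e by rewrite ltW// (lt_le_trans xl)// lerD2l.
    have x2 : x <= lo + n.+1%:R^-1 by rewrite ltW// (lt_le_trans xl)// lerD2l.
    by rewrite P_lo// F_lo// mulr0 subr0.
  have x1 : hi - e <= x by rewrite ltW// (le_lt_trans _ xh)// lerD2l lerN2.
  have x2 : hi - n.+1%:R^-1 <= x by rewrite ltW// (le_lt_trans _ xh)// lerD2l lerN2.
  by rewrite P_hi// F_hi'// /k divfK ?subrr// gt_eqF.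
have kM n : `|k n| <= M * L / F hi.
  rewrite normrM normfV (gtr0_norm Fhi0) ler_wpM2r ?invr_ge0 ?(ltW Fhi0)//.
  by rewrite PM// lexx ltW.
have psiM n x : `|psi n x| <= M + M * L / F hi.
  rewrite (le_trans (ler_normB _ _))// lerD// normrM.
  by rewrite -[leRHS]mulr1 ler_pM.
have C0 : 0 <= M + M * L / F hi by rewrite addr_ge0// !mulr_ge0 ?invr_ge0 ?(ltW L0) ?(ltW Fhi0).
have Pcvg x : lo <= x <= hi -> P n x @[n --> \oo] --> f x.
  move=> /andP[]; rewrite le_eqVlt => /predU1P[<-{x} _|lox xhi].
    rewrite f_lo; apply: cvg_near_cst; apply: nearW => n.
    by rewrite P_lo// ltW.
  rewrite -[f x]subr0 -f_lo -pw_derive_FTC//.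
  apply: (@bounded_cvg_Rintegral _ _ _ _ _ _ _ M) => //.
  - by apply: compact_finite_measure; exact: segment_compact.
  - move=> n; apply: measurable_funTS; apply: continuous_measurable_fun.
    exact: smooth1_continuous (smooth1_approx_derive _).
  - by move=> y _; exact: approx_derive_cvg.
have ko : k n @[n --> \oo] --> 0.
  rewrite -[X in _ --> X](mul0r (F hi)^-1) -f_hi; apply: cvgMr_tmp.
  by apply: Pcvg; rewrite lexx ltW.
(* The first entry bounds the derivative; the second bounds [phi n], which starts from 0 at [lo], by
   the derivative bound times the length [L]. *)
exists phi, (Num.max (M + M * L / F hi) ((M + M * L / F hi) * L)); split.
- move=> n [//|m]; apply: (Ck_is_derive (dphi n)).
  rewrite (_ : psi n = p n \+ (cst (- k n) \* rho)).
    by apply: CkD; [exact: smooth1_approx_derive|apply: CkM; [exact: Ck_cst|exact: Srho]].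
  by apply/funext => x /=; rewrite /psi mulNr.
- by move=> n; exists (dl n) => // x; exact: phi_out.
- move=> n x; split; last by rewrite phi' le_max psiM.
  rewrite le_max; apply/orP; right.
  have [xl|xl] := boolP (lo <= x <= hi).
    apply: (derive_bound_segment C0 (dphi n)) xl => //.
    by rewrite /phi P_lo ?F_lo ?mulr0 ?subr0// ltW.
  rewrite phi_out; first by rewrite normr0 mulr_ge0// ltW.
  apply: contra xl => /andP[x1 x2].
  apply/andP; split; first by rewrite (le_trans _ x1)// lerDl ltW.
  by rewrite (le_trans x2)// gerBl ltW.
- move=> x xl; split; last first.
    under eq_fun do rewrite phi'.
    have := cvgB (@approx_derive_cvg x) (cvgMr_tmp (b := rho x) ko).
    by rewrite mul0r subr0; exact.
  have := cvgB (Pcvg _ xl) (cvgMr_tmp (b := F x) ko).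
  by rewrite mul0r subr0; exact.
Qed.

End approx1.

(** * Lebesgue measure on R^n *)

Section rV_measure.
Context {R : realType}.

Lemma coord_ballP n (x y : 'rV[R]_n) e : 0 < e ->
  ball x e y <-> forall i, `|x 0 i - y 0 i| < e.
Proof.
move=> e0; split=> [[_ xy] i|xy]; first exact: xy.
by split=> // i j; rewrite ord1; exact: xy.
Qed.

Lemma measurable_coord_itv n (i : 'I_n) (I : interval R) :
  measurable [set x : 'rV[R]_n | x 0 i \in I].
Proof.
rewrite -[X in measurable X]setTI.
exact: (measurable_coord i measurableT (measurable_itv I)).
Qed.

(** The sigma-algebra is generated by the coordinates. It contains all rational cubes, and an open
    set is the countable union of those that it includes. *)
Lemma open_measurable_rV n (U : set 'rV[R]_n) : open U -> measurable U.
Proof.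
move=> oU.
pose cube (q : 'rV[rat]_n) (k : nat) : set 'rV[R]_n :=
  [set x | forall i, ratr (q 0 i) - k.+1%:R^-1 < x 0 i < ratr (q 0 i) + k.+1%:R^-1].
have -> : U = \bigcup_(qk : 'rV[rat]_n * nat)
    (if `[< cube qk.1 qk.2 `<=` U >] then cube qk.1 qk.2 else set0).
  apply/seteqP; split=> [x Ux|x [qk _]]; last by case: asboolP => [qkU /qkU|].
  have [e /= e0 xeU] := (@nbhs_ballP _ _ x U).1 (open_nbhs_nbhs (conj oU Ux)).
  (* A cube of half-width 1/(k+1) that contains [x] then stays within [e] of [x]. *)
  have [k ke] : exists k, k.+1%:R^-1 < e / 2.
    have [k _ /(_ k (leqnn k))] := near_infty_natSinv_lt (PosNum (divr_gt0 e0 (ltr0n R 2))).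
    by exists k.
  have k0 : 0 < k.+1%:R^-1 :> R by [].
  have /choice[q qx] : forall i, exists r : rat, x 0 i - k.+1%:R^-1 < ratr r < x 0 i + k.+1%:R^-1.
    move=> i; have /rat_in_itvoo[r] : x 0 i - k.+1%:R^-1 < x 0 i + k.+1%:R^-1.
      by rewrite ltrBlDr -addrA ltrDl addr_gt0.
    by rewrite inE/= => ?; exists r.
  exists (\row_i q i, k) => //=; case: asboolP => [_ i|[]].
    by rewrite mxE; have /andP[q1 q2] := qx i; rewrite ltrBlDr q2 -ltrBlDr q1.
  move=> y /= qy; apply: xeU; apply/coord_ballP => // i.
  have := qy i; rewrite mxE => /andP[y1 y2]; have /andP[x1 x2] := qx i.
  move: ke y1 y2 x1 x2; move: (k.+1%:R^-1) (ratr (q i)) (x 0 i) (y 0 i) => /= k' q' x' y' *.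
  rewrite ltr_norml; apply/andP; split; lra.
apply: countable_bigcupT_measurable => [|qk]; first exact: countableP.
case: asboolP => [_|_]; last exact: measurable0.
rewrite (_ : cube _ _ = \bigcap_i [set x |
    ratr (qk.1 0 i) - qk.2.+1%:R^-1 < x 0 i < ratr (qk.1 0 i) + qk.2.+1%:R^-1]); last first.
  by apply/seteqP; split=> x => [xq i _|xq i]; exact: xq.
apply: fin_bigcap_measurable => // i _.
have := measurable_coord_itv i
  `](ratr (qk.1 0 i) - qk.2.+1%:R^-1), (ratr (qk.1 0 i) + qk.2.+1%:R^-1)[.
by under eq_set do rewrite in_itv/=.
Qed.

Lemma continuous_measurable_rV n (f : 'rV[R]_n -> R) :
  continuous f -> measurable_fun setT f.
Proof.
move=> /continuousP cf; apply: (measurability _ (RGenOpens.measurableE R)).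
move=> _ [_ [a [b ->] <-]]; rewrite setTI; apply: open_measurable_rV.
exact/cf/interval_open.
Qed.

Lemma measurable_box n (lo hi : 'I_n -> R) : measurable (box lo hi).
Proof.
rewrite (_ : box lo hi = \bigcap_i [set x | lo i <= x 0 i <= hi i]); last first.
  by apply/seteqP; split=> x => [xq i _|xq i]; exact: xq.
apply: fin_bigcap_measurable => // i _.
have := measurable_coord_itv i `[lo i, hi i].
by under eq_set do rewrite in_itv/=.
Qed.

Lemma cons_rV0 n (s : R) (y : 'rV[R]_n) : cons_rV (s, y) 0 ord0 = s.
Proof. by rewrite /cons_rV mxE unlift_none. Qed.

Lemma cons_rVS n (s : R) (y : 'rV[R]_n) i : cons_rV (s, y) 0 (lift ord0 i) = y 0 i.
Proof. by rewrite /cons_rV mxE liftK. Qed.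

Lemma cons_rV_boxP n (lo hi : 'I_n.+1 -> R) (p : measurableTypeR R * 'rV[R]_n) :
  box lo hi (cons_rV p) <-> lo ord0 <= p.1 <= hi ord0 /\
    box (fun i => lo (lift ord0 i)) (fun i => hi (lift ord0 i)) p.2.
Proof.
case: p => s y; split=> [H|[H0 H] i].
  split; first by have := H ord0; rewrite cons_rV0.
  by move=> i; have := H (lift ord0 i); rewrite cons_rVS.
by case: (unliftP ord0 i) => [j ->|->]; rewrite ?cons_rVS ?cons_rV0.
Qed.

Lemma lebesgue_rV_box n (lo hi : 'I_n -> R) : (lebesgue_rV n (box lo hi) < +oo)%E.
Proof.
elim: n lo hi => [|n IH] lo hi.
  by rewrite /= diracE ltry.
rewrite /= /lebesgue_cons /pushforward.
rewrite (_ : _ @^-1` _ = `[lo ord0, hi ord0] `*`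
    box (fun i => lo (lift ord0 i)) (fun i => hi (lift ord0 i))); last first.
  by apply/seteqP; split=> p; rewrite /preimage/= cons_rV_boxP in_itv.
rewrite product_measure1E//; last exact: measurable_box.
rewrite lte_mul_pinfty ?IH// ge0_fin_numE//.
by apply: compact_finite_measure; exact: segment_compact.
Qed.

Definition set_coord n (i : 'I_n) (s : R) (x : 'rV[R]_n) : 'rV[R]_n :=
  \row_j (if j == i then s else x 0 j).

Lemma bounded_supp_integrable d (T : measurableType d) (mu : {measure set T -> \bar R})
    (K : set T) (F : T -> R) (M : R) :
  measurable K -> (mu K < +oo)%E -> measurable_fun setT F ->
  (forall x, `|F x| <= M) -> (forall x, ~ K x -> F x = 0) ->
  mu.-integrable setT (EFin \o F).
Proof.
move=> mK Kfin mF FM F0.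
have -> : EFin \o F = (EFin \o F) \_ K.
  apply/funext => x; rewrite /patch; case: ifPn => //= xK; rewrite F0//.
  by move=> /mem_set; apply/negP.
apply/(integrable_mkcond _ mK); apply: measurable_bounded_integrable => //.
  exact: measurable_funTS.
by exists M; split=> [|N MN x _]; [exact: num_real|rewrite /= (le_trans (FM x))// ltW].
Qed.

(** Fubini, by induction on the dimension since the measure is built one coordinate at a time.
    Boundedness and support in a box give integrability, so either order of integration is
    allowed. *)
Lemma line_integral0 n (i : 'I_n) (lo hi : 'I_n -> R) (F : 'rV[R]_n -> R) (M : R) :
  measurable_fun setT F -> (forall x, `|F x| <= M) ->
  (forall x, ~ box lo hi x -> F x = 0) ->
  (forall x, \int[@lebesgue_measure R]_s (F (set_coord i s x))%:E = 0)%E ->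
  (\int[lebesgue_rV n]_x (F x)%:E = 0)%E.
Proof.
elim: n i lo hi F => [[]//|n IH] i lo hi F mF FM F0 Fi.
have mFc : measurable_fun setT (F \o @cons_rV R n).
  by apply: measurableT_comp => //; exact: measurable_cons_rV.
have bP := @cons_rV_boxP n lo hi.
have iF : ((@lebesgue_measure R) \x (lebesgue_rV n))%E.-integrable setT
    (EFin \o (F \o @cons_rV R n)).
  apply: (@bounded_supp_integrable _ _ _ (@cons_rV R n @^-1` box lo hi) _ M) => //.
  - rewrite -[X in measurable X]setTI; apply: measurable_cons_rV => //; exact: measurable_box.
  - exact: (lebesgue_rV_box lo hi).
  - by move=> p; exact: FM.
  - by move=> p Kp; exact: (F0 _ Kp).
have := @integral_pushforward _ _ _ _ R (@cons_rV R n) (@measurable_cons_rV R n)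
  (@lebesgue_measure R \x lebesgue_rV n)%E setT (EFin \o F) ((measurable_EFinP _ _).2 mF)
  iF measurableT.
move=> ->; rewrite preimage_setT.
(* The order of integration is chosen so that either the induction hypothesis or
   the integral over coordinate i applies to the inner integral. *)
case: (unliftP ord0 i) => [j ij|i0].
- rewrite -[LHS]integral12_prod_meas1//= /fubini_F.
  rewrite integral0_eq// => s _.
  apply: (IH j (fun i => lo (lift ord0 i)) (fun i => hi (lift ord0 i))) => //.
  + apply: measurableT_comp mF _; apply: measurableT_comp (@measurable_cons_rV R n) _.
    exact: pair1_measurable.
  + move=> y By; apply: F0 => /bP[_]; exact: By.
  + move=> y.
    have := Fi (cons_rV (s, y)).
    congr (_ = _); apply: eq_integral => t _; congr (F _)%:E.
    apply/rowP => k; rewrite [LHS]mxE ij; case: (unliftP ord0 k) => [k' ->|->].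
      by rewrite (inj_eq lift_inj) !cons_rVS mxE.
    by rewrite !cons_rV0 (negPf (neq_lift _ _)).
- rewrite -[LHS]integral21_prod_meas1//= /fubini_G.
  rewrite integral0_eq// => y _.
  have := Fi (cons_rV (0, y)).
  congr (_ = _); apply: eq_integral => t _; congr (F _)%:E.
  apply/rowP => k; rewrite [LHS]mxE i0; case: (unliftP ord0 k) => [k' ->|->].
    by rewrite eq_sym (negPf (neq_lift _ _)) !cons_rVS.
  by rewrite eqxx cons_rV0.
Qed.

End rV_measure.

(** * Test functions *)

Section test_functions.
Context {R : realType} {d : nat}.
Implicit Types (Omega : set 'rV[R]_d) (phi psi : 'rV[R]_d -> R).

Lemma test_function_continuous Omega phi : test_function Omega phi -> continuous phi.
Proof. by case=> /(_ [::])[]. Qed.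

Lemma test_function_derivable Omega phi i x : test_function Omega phi ->
  derivable phi x (delta_mx 0 i).
Proof. by case=> /(_ [::])[_ +] _; exact. Qed.

Lemma test_function_partial_continuous Omega phi i :
  test_function Omega phi -> continuous (partial i phi).
Proof. by case=> /(_ [:: i])[]. Qed.

Lemma test_function_notin Omega phi x : test_function Omega phi -> ~ Omega x -> phi x = 0.
Proof.
move=> [_ [K [_ KO phi0]]] Ox; apply: phi0 => /KO Kx; apply: Ox.
exact: interior_subset.
Qed.

Lemma rV_hausdorff : hausdorff_space 'rV[R]_d.
Proof. exact: norm_hausdorff. Qed.

(** The complement of the compact support set is open, so [phi] is locally 0 at its points and the
    derivative vanishes there too. *)
Lemma test_function_partial0 Omega phi i : test_function Omega phi ->
  exists K, [/\ compact K, K `<=` Omega° & forall x, ~ K x -> phi x = 0 /\ partial i phi x = 0].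
Proof.
move=> [_ [K [cK KO phi0]]]; exists K; split => // x Kx; split; first exact: phi0.
rewrite /partial (_ : 0 = 'D_(delta_mx 0 i) (cst 0 : 'rV[R]_d -> R) x); last by rewrite derive_cst.
apply: near_eq_derive.
have oK : open (~` K) by apply: closed_openC; exact: compact_closed rV_hausdorff cK.
by apply: filterS (open_nbhs_nbhs (conj oK Kx)) => y /phi0.
Qed.

Lemma compact_supp_bound (K : set 'rV[R]_d) phi : compact K -> continuous phi ->
  (forall x, ~ K x -> phi x = 0) -> exists2 M, 0 <= M & forall x, `|phi x| <= M.
Proof.
move=> cK cphi phi0; have [M phiM] := compact_bound cK cphi.
exists (Num.max M 0) => [|x]; first by rewrite le_max lexx orbT.
rewrite le_max; have [/phiM->//|/phi0->] := pselect (K x).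
by rewrite normr0 lexx orbT.
Qed.

Lemma test_function_bound Omega phi : test_function Omega phi ->
  exists2 M, 0 <= M & forall x, `|phi x| <= M.
Proof.
move=> tphi; have cphi := test_function_continuous tphi.
by case: tphi => _ [K [cK _ phi0]]; exact: compact_supp_bound cK cphi phi0.
Qed.

Lemma test_function_partial_bound Omega phi i : test_function Omega phi ->
  exists2 M, 0 <= M & forall x, `|partial i phi x| <= M.
Proof.
move=> tphi; have cphi := @test_function_partial_continuous _ _ i tphi.
have [K [cK _ phi0]] := @test_function_partial0 _ _ i tphi.
by apply: compact_supp_bound cK cphi _ => x /phi0[].
Qed.

Lemma partial_linear k phi psi i x : derivable phi x (delta_mx 0 i) ->
  derivable psi x (delta_mx 0 i) ->
  derivable (fun x => k * phi x + psi x) x (delta_mx 0 i) /\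
  partial i (fun x => k * phi x + psi x) x = k * partial i phi x + partial i psi x.
Proof.
move=> dphi dpsi.
have [dD eD] := is_deriveD (is_deriveZ k (derivableP dphi)) (derivableP dpsi).
by split; [exact: dD|exact: eD].
Qed.

Lemma smooth_linear k phi psi : smooth phi -> smooth psi ->
  smooth (fun x => k * phi x + psi x).
Proof.
move=> Sphi Spsi.
have E s : foldr partial (fun x => k * phi x + psi x) s =
    (fun x => k * foldr partial phi s x + foldr partial psi s x).
  elim: s => //= i s IH; rewrite IH; apply/funext => x.
  by have [] := @partial_linear k _ _ i x ((Sphi s).2 i x) ((Spsi s).2 i x).
move=> s; rewrite E; split=> [x|i x]; last first.
  by have [] := @partial_linear k _ _ i x ((Sphi s).2 i x) ((Spsi s).2 i x).
exact: (cvgD (cvgMl_tmp (a := k) ((Sphi s).1 x)) ((Spsi s).1 x)).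
Qed.

Lemma test_function_linear Omega k phi psi : test_function Omega phi ->
  test_function Omega psi -> test_function Omega (fun x => k * phi x + psi x).
Proof.
move=> [Sphi [K [cK KO phi0]]] [Spsi [L [cL LO psi0]]].
split; first exact: smooth_linear.
exists (K `|` L); split; first exact: compactU.
  by move=> x [/KO|/LO].
by move=> x /not_orP[Kx Lx]; rewrite phi0// psi0// mulr0 addr0.
Qed.

Lemma is_derive_line phi (v y : 'rV[R]_d) (s : R) : derivable phi (s *: v + y) v ->
  is_derive (s : R) (1 : R) (fun s => phi (s *: v + y)) ('D_v phi (s *: v + y)).
Proof.
move=> dphi.
have E : (fun h : R => h^-1 *: (phi (h *: v + (s *: v + y)) - phi (s *: v + y))) =
    (fun h : R => h^-1 *: (phi ((h *: 1 + s) *: v + y) - phi (s *: v + y))).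
  by apply/funext => h; rewrite scaler1 scalerDl addrA.
apply: DeriveDef; first by move: dphi; rewrite /derivable /= E.
by rewrite /derive /= E.
Qed.

Lemma set_coordE (i : 'I_d) s (x : 'rV[R]_d) :
  set_coord i s x = s *: delta_mx 0 i + set_coord i 0 x.
Proof.
apply/rowP => j; rewrite !mxE eqxx/=; case: eqP => _ /=; rewrite ?mulr1 ?addr0//.
by rewrite mulr0 add0r.
Qed.

Lemma set_coord_continuous (i : 'I_d) (x : 'rV[R]_d) :
  continuous (fun s : R => s *: delta_mx 0 i + set_coord i 0 x).
Proof.
by move=> s; apply: cvgD; [apply: cvgZl; exact: cvg_id|exact: cvg_cst].
Qed.

Section box.
Variables lo hi : 'I_d -> R.
Local Notation Omega := (box lo hi).
Local Notation mu := (lebesgue_rV d : {measure set 'rV[R]_d -> \bar R}).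

Lemma bounded_integrable_box (F : 'rV[R]_d -> R) (M : R) :
  measurable_fun setT F -> (forall x, `|F x| <= M) -> mu.-integrable Omega (EFin \o F).
Proof.
move=> mF FM; apply: measurable_bounded_integrable.
- exact: measurable_box.
- exact: lebesgue_rV_box.
- exact: measurable_funTS.
- by exists M; split=> [|N MN x _]; [exact: num_real|rewrite /= (le_trans (FM x))// ltW].
Qed.

(** The two integrands add up to the partial derivative of [phi * psi], whose integral along each
    line parallel to axis [i] is 0. *)
Lemma test_function_ibp phi psi i : test_function Omega phi -> test_function Omega psi ->
  \int[mu]_(x in Omega) (phi x * partial i psi x) =
  - \int[mu]_(x in Omega) (partial i phi x * psi x).
Proof.
move=> tphi tpsi.
have cphi := test_function_continuous tphi.
have cpsi := test_function_continuous tpsi.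
have cdphi := @test_function_partial_continuous _ _ i tphi.
have cdpsi := @test_function_partial_continuous _ _ i tpsi.
have [A A0 phiA] := test_function_bound tphi.
have [B B0 psiB] := test_function_bound tpsi.
have [A' A'0 phiA'] := @test_function_partial_bound _ _ i tphi.
have [B' B'0 psiB'] := @test_function_partial_bound _ _ i tpsi.
pose F1 x := phi x * partial i psi x.
pose F2 x := partial i phi x * psi x.
have cF1 : continuous F1 by move=> x; exact: (cvgM (cphi x) (cdpsi x)).
have cF2 : continuous F2 by move=> x; exact: (cvgM (cdphi x) (cpsi x)).
have mF1 := continuous_measurable_rV cF1.
have mF2 := continuous_measurable_rV cF2.
have F1M x : `|F1 x| <= A * B' by rewrite normrM ler_pM.
have F2M x : `|F2 x| <= A' * B by rewrite normrM ler_pM.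
apply/eqP; rewrite -addr_eq0 -RintegralD.
- rewrite /Rintegral (_ : (\int[_]_(_ in _) _)%E = 0%E)// integral_mkcond.
  pose F x := F1 x + F2 x.
  have cF : continuous F by move=> x; exact: (cvgD (cF1 x) (cF2 x)).
  have F0 x : ~ Omega x -> F x = 0.
    move=> Ox; rewrite /F /F1 /F2 (test_function_notin tphi)//.
    by rewrite (test_function_notin tpsi)// mul0r mulr0 addr0.
  transitivity (\int[mu]_x (F x)%:E)%E.
    apply: eq_integral => x _; rewrite /patch; case: ifPn => // xO.
    by rewrite F0//; move=> /mem_set; apply/negP.
  apply: (@line_integral0 R d i lo hi F (A * B' + A' * B)).
  + exact: measurable_funD.
  + by move=> x; rewrite (le_trans (ler_normD _ _))// lerD.
  + exact: F0.
  move=> x.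
  pose l (s : R) := s *: delta_mx 0 i + set_coord i 0 x.
  under eq_integral do rewrite set_coordE -/(l _).
  pose P s := phi (l s) * psi (l s).
  have dP (s : R) : is_derive (s : R) (1 : R) P (F (l s)).
    have := is_deriveM (is_derive_line (@test_function_derivable _ _ i (l s) tphi))
      (is_derive_line (@test_function_derivable _ _ i (l s) tpsi)).
    by rewrite /F /F1 /F2 [X in _ + X]mulrC.
  (* Both ends lie strictly outside the side of the box, so [P] vanishes at them; the maximum keeps
     [a < b] even if [hi i < lo i]. *)
  pose a := lo i - 1; pose b := Num.max (hi i) (lo i) + 1.
  have ab : a < b by rewrite /a /b ltrBlDr -addrA ltr_pwDr// ?le_max ?lexx ?orbT ?addr_gt0.
  have out s : s \notin `[lo i, hi i] -> ~ Omega (l s).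
    move=> sl /(_ i); rewrite /l -set_coordE mxE eqxx => H.
    by move: sl; rewrite in_itv/= H.
  have P0 s : s \notin `[lo i, hi i] -> P s = 0.
    by move=> /out H; rewrite /P (test_function_notin tphi)// mul0r.
  transitivity (\int[@lebesgue_measure R]_(s in `[a, b]) (F (l s))%:E)%E.
    rewrite [RHS]integral_mkcond; apply: eq_integral => s _; rewrite /patch.
    case: ifPn => // sab; rewrite F0//; apply: out.
    apply: contra sab; rewrite inE/= !in_itv/= /a /b => /andP[s1 s2].
    rewrite lerBlDr (le_trans s1) ?lerDl//= (@le_trans _ _ (hi i))//.
    by rewrite (@le_trans _ _ (Num.max (hi i) (lo i)))// ?lerDl// le_max lexx.
  rewrite (@continuous_FTC2 _ (F \o l) P)//.
  + have aO : a \notin `[lo i, hi i] by rewrite in_itv/= /a lerBrDr gerDl ler10.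
    have bO : b \notin `[lo i, hi i].
      rewrite in_itv/= negb_and /b -!ltNge; apply/orP; right.
      by rewrite (@le_lt_trans _ _ (Num.max (hi i) (lo i)))// ?ltrDl// le_max lexx.
    by rewrite !P0// -EFinB subrr.
  + apply: continuous_subspaceT => s; apply: continuous_comp; first exact: set_coord_continuous.
    exact: cF.
  + have cP := is_derive_continuous dP.
    by split; [move=> s _; exact: ex_derive|exact/cvg_at_right_filter/cP|exact/cvg_at_left_filter/cP].
  + by move=> s _; rewrite derive1E derive_val.
- exact: measurable_box.
- exact: bounded_integrable_box F1M.
- exact: bounded_integrable_box F2M.
Qed.

End box.
End test_functions.

(** * The space H^1_0 of a box *)

Section H10_space.
Context {R : realType} {d : nat}.
Variables lo hi : 'I_d -> R.
Local Notation Omega := (box lo hi).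
Local Notation mu := (lebesgue_rV d : {measure set 'rV[R]_d -> \bar R}).
Implicit Types (u v w phi psi : 'rV[R]_d -> R) (g h : 'rV[R]_d -> 'rV[R]_d).

Lemma L2P u : L2 Omega u <->
  measurable_fun Omega u /\ mu.-integrable Omega (EFin \o (fun x => u x ^+ 2)).
Proof.
split=> -[mesu u2]; split => //.
  apply/integrableP; split; first exact/measurable_EFinP/measurable_funX.
  by under eq_integral do rewrite /= ger0_norm ?sqr_ge0//.
by have /integrableP[_] := u2; under eq_integral do rewrite /= ger0_norm ?sqr_ge0//.
Qed.

Lemma L2_linear k u v : L2 Omega u -> L2 Omega v -> L2 Omega (fun x => k * u x + v x).
Proof.
move=> /L2P[mesu u2] /L2P[mv v2]; apply/L2P.
have mw : measurable_fun Omega (fun x => k * u x + v x).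
  by apply: measurable_funD => //; exact: measurable_funM.
split => //.
have i2 := integrableD (measurable_box lo hi)
  (integrableZl (measurable_box lo hi) (2 * k ^+ 2) u2)
  (integrableZl (measurable_box lo hi) 2 v2).
apply: le_integrable i2; first exact: measurable_box.
  exact/measurable_EFinP/measurable_funX.
move=> x _; rewrite -EFinM -EFinM -EFinD !abse_EFin lee_fin.
rewrite (ger0_norm (sqr_ge0 _)); apply: le_trans (ler_norm _).
have := sqr_ge0 (k * u x - v x); nra.
Qed.

Lemma normr_le_add_sqr (y : R) : `|y| <= `|1 + y ^+ 2|.
Proof.
rewrite (@ger0_norm _ (1 + _)) ?addr_ge0 ?sqr_ge0// ler_norml.
by have := sqr_ge0 (y - 1); have := sqr_ge0 (y + 1); nra.
Qed.

(** On a set of finite measure square integrability gives integrability, through |y| <= 1 + y^2. *)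
Lemma L2_mul_integrable u w (M : R) : L2 Omega u -> measurable_fun Omega w ->
  (forall x, Omega x -> `|w x| <= M) -> mu.-integrable Omega (EFin \o (fun x => u x * w x)).
Proof.
move=> /L2P[mesu u2] mw wM.
have i1 : mu.-integrable Omega (EFin \o cst (1 : R)).
  apply: measurable_bounded_integrable => //; first exact: measurable_box.
    exact: lebesgue_rV_box.
  exact: bounded_cst.
have i2 := integrableZl (measurable_box lo hi) M (integrableD (measurable_box lo hi) i1 u2).
apply: le_integrable i2; first exact: measurable_box.
  exact/measurable_EFinP/measurable_funM.
move=> x Ox; rewrite -EFinD -EFinM !abse_EFin lee_fin /= [leLHS]normrM mulrC.
have M0 : 0 <= M by apply: le_trans (wM _ Ox).
rewrite [leRHS]normrM; apply: ler_pM => //; first by rewrite (le_trans (wM _ Ox))// ler_norm.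
exact: normr_le_add_sqr.
Qed.

Lemma weak_gradient_linear k u v g h :
  L2 Omega u -> L2 Omega v ->
  (forall i, L2 Omega (fun x => g x 0 i)) -> (forall i, L2 Omega (fun x => h x 0 i)) ->
  weak_gradient Omega u g -> weak_gradient Omega v h ->
  weak_gradient Omega (fun x => k * u x + v x) (fun x => k *: g x + h x).
Proof.
move=> Lu Lv Lg Lh wu wv psi tpsi i.
have [B B0 psiB] := test_function_bound tpsi.
have [B' B'0 psiB'] := test_function_partial_bound i tpsi.
have mpsi : measurable_fun Omega psi.
  by apply: measurable_funTS; apply: continuous_measurable_rV; exact: test_function_continuous tpsi.
have mdpsi : measurable_fun Omega (partial i psi).
  apply: measurable_funTS; apply: continuous_measurable_rV.
  exact: test_function_partial_continuous tpsi.
have mO := measurable_box lo hi.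
have lin (f1 f2 w : 'rV[R]_d -> R) M : L2 Omega f1 -> L2 Omega f2 ->
    measurable_fun Omega w -> (forall x, `|w x| <= M) ->
    \int[mu]_(x in Omega) ((k * f1 x + f2 x) * w x) =
    k * \int[mu]_(x in Omega) (f1 x * w x) + \int[mu]_(x in Omega) (f2 x * w x).
  move=> L1 L2_ mw wM.
  have i1 := L2_mul_integrable L1 mw (fun x _ => wM x).
  have i2 := L2_mul_integrable L2_ mw (fun x _ => wM x).
  rewrite -RintegralZl// -RintegralD//; last exact: (integrableZl mO k i1).
  by apply: eq_Rintegral => x _; ring.
rewrite (lin _ _ _ _ Lu Lv mdpsi psiB').
under [X in _ = - X]eq_Rintegral do rewrite !mxE.
by rewrite (lin _ _ _ _ (Lg i) (Lh i) mpsi psiB) wu// wv//; ring.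
Qed.

Definition H1_dist_integrand u g phi x :=
  (u x - phi x) ^+ 2 + \sum_(i < d) (g x 0 i - partial i phi x) ^+ 2.

Lemma H1_dist_integrand_ge0 u g phi x : 0 <= H1_dist_integrand u g phi x.
Proof. by rewrite addr_ge0 ?sqr_ge0// sumr_ge0// => i _; exact: sqr_ge0. Qed.

Lemma measurable_H1_dist u g phi : measurable_fun Omega u ->
  (forall i, measurable_fun Omega (fun x => g x 0 i)) -> test_function Omega phi ->
  measurable_fun Omega (H1_dist_integrand u g phi).
Proof.
move=> mesu mg tphi; apply: measurable_funD.
  apply: measurable_funX; apply: measurable_funB => //.
  by apply: measurable_funTS; apply: continuous_measurable_rV; exact: test_function_continuous tphi.
apply: measurable_sum => i; apply: measurable_funX; apply: measurable_funB => //.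
apply: measurable_funTS; apply: continuous_measurable_rV.
exact: test_function_partial_continuous tphi.
Qed.

Lemma H10_linear k u v : H10 Omega u -> H10 Omega v -> H10 Omega (fun x => k * u x + v x).
Proof.
move=> [g [Lu Lg wu] appu] [h [Lv Lh wv] appv].
have Lgh i : L2 Omega (fun x => (k *: g x + h x) 0 i).
  rewrite (_ : (fun x => _) = fun x => k * g x 0 i + h x 0 i); first exact: L2_linear.
  by apply/funext => x; rewrite !mxE.
have Luv := L2_linear k Lu Lv.
exists (fun x => k *: g x + h x); first by split => //; exact: weak_gradient_linear.
move=> eps eps0.
have k1 : 0 < k ^+ 2 + 1 by rewrite ltr_wpDl ?sqr_ge0.
(* Squared errors combine with weights [2 * k ^+ 2] and 2, so the total is at most eps/2 + eps/4;
   the added 1 covers [k = 0]. *)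
pose e1 := eps / (4 * (k ^+ 2 + 1)).
have [|phi tphi dphi] := appu e1; first by rewrite divr_gt0// mulr_gt0.
have [|psi tpsi dpsi] := appv (eps / 8); first by rewrite divr_gt0.
have tphipsi := test_function_linear k tphi tpsi.
exists (fun x => k * phi x + psi x) => //.
have mO := measurable_box lo hi.
have k2 : 0 <= 2 * k ^+ 2 by rewrite mulr_ge0// sqr_ge0.
have m1 : measurable_fun Omega (H1_dist_integrand u g phi).
  by apply: measurable_H1_dist => //; [case: Lu|move=> i; case: (Lg i)].
have m2 : measurable_fun Omega (H1_dist_integrand v h psi).
  by apply: measurable_H1_dist => //; [case: Lv|move=> i; case: (Lh i)].
have mE (f : 'rV[R]_d -> R) : measurable_fun Omega f -> measurable_fun Omega (EFin \o f).
  by move=> mf; exact/measurable_EFinP.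
rewrite /H1_dist2.
apply: (@le_lt_trans _ _ (\int[mu]_(x in Omega) (
    (2 * k ^+ 2)%:E * (H1_dist_integrand u g phi x)%:E
    + 2%:E * (H1_dist_integrand v h psi x)%:E))%E).
  apply: ge0_le_integral => //.
  - by move=> x _; rewrite lee_fin addr_ge0 ?sqr_ge0// sumr_ge0// => i _; exact: sqr_ge0.
  - apply/measurable_EFinP; apply: (measurable_H1_dist _ _ tphipsi); first by case: Luv.
    by move=> i; case: (Lgh i).
  - apply: emeasurable_funD; apply: measurable_funeM; exact: mE.
  move=> x _; rewrite -!EFinM -EFinD lee_fin /H1_dist_integrand.
  rewrite !mulrDr addrACA !mulr_sumr -big_split/= lerD//.
    have := sqr_ge0 (k * (u x - phi x) - (v x - psi x)); nra.
  apply: ler_sum => i _; rewrite !mxE.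
  have [_ ->] := @partial_linear R d k phi psi i x (@test_function_derivable _ _ _ _ i x tphi)
    (@test_function_derivable _ _ _ _ i x tpsi).
  move: (g x 0 i) (h x 0 i) (partial i phi x) (partial i psi x) => y1 y2 y3 y4.
  have := sqr_ge0 (k * (y1 - y3) - (y2 - y4)); nra.
rewrite ge0_integralD//; last 4 first.
- by move=> x _; rewrite -EFinM lee_fin mulr_ge0// H1_dist_integrand_ge0.
- apply: measurable_funeM; exact: mE.
- by move=> x _; rewrite -EFinM lee_fin mulr_ge0// H1_dist_integrand_ge0.
- apply: measurable_funeM; exact: mE.
rewrite (ge0_integralZl mu mO (mE _ m1)); last 2 first.
- by move=> x _; rewrite lee_fin H1_dist_integrand_ge0.
- by rewrite lee_fin.
rewrite (ge0_integralZl mu mO (mE _ m2)); last 2 first.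
- by move=> x _; rewrite lee_fin H1_dist_integrand_ge0.
- by rewrite lee_fin.
apply: (@le_lt_trans _ _ ((2 * k ^+ 2)%:E * e1%:E + 2%:E * (eps / 8)%:E)%E).
  by apply: leeD; apply: lee_wpmul2l; rewrite ?lee_fin//; exact: ltW.
rewrite -!EFinM -EFinD lte_fin.
have -> : 2 * k ^+ 2 * e1 = (eps / 2) * (k ^+ 2 / (k ^+ 2 + 1)) by rewrite /e1; field; rewrite gt_eqF.
have : k ^+ 2 / (k ^+ 2 + 1) <= 1 by rewrite ler_pdivrMr// mul1r lerDl.
by move: (k ^+ 2 / _) => q q1; nra.
Qed.

(** Functions on the box are represented by total functions, and the expansion of a FEM function is
    known on the box only. *)
Lemma H10_ext u v : (forall x, Omega x -> u x = v x) -> H10 Omega u -> H10 Omega v.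
Proof.
move=> uv [g [[mesu u2] Lg wu] app]; exists g; first split => //.
- split.
    by apply: eq_measurable_fun mesu => x; rewrite inE => /uv.
  by move: u2; congr (_ < _)%E; apply: eq_integral => x; rewrite inE => /uv ->.
- move=> phi tphi i; rewrite -wu//; apply: eq_Rintegral => x; rewrite inE => /uv ->//.
move=> eps /app[phi tphi dphi]; exists phi => //; move: dphi; congr (_ < _)%E.
by apply: eq_integral => x; rewrite inE => /uv ->.
Qed.

Lemma bounded_L2 u (M : R) : measurable_fun Omega u ->
  (forall x, Omega x -> `|u x| <= M) -> L2 Omega u.
Proof.
move=> mesu uM; apply/L2P; split => //.
have mO := measurable_box lo hi.
apply: measurable_bounded_integrable => //; [exact: lebesgue_rV_box|exact: measurable_funX|].
exists (M ^+ 2); split=> [|N MN x Ox]; first exact: num_real.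
by rewrite /= normrX (le_trans _ (ltW MN))// lerXn2r ?nnegrE ?uM// (le_trans _ (uM _ Ox)).
Qed.

(** The uniform bound passes to [u] and [g] and dominates every integral. Hence integration by parts
    for [Phi n] survives in the limit, making [g] the weak gradient, and the distance in H^1 tends
    to 0. *)
Lemma H10_bounded_limit (Phi : nat -> 'rV[R]_d -> R) u g (M : R) :
  (forall n, test_function Omega (Phi n)) ->
  (forall n x, `|Phi n x| <= M) -> (forall n i x, `|partial i (Phi n) x| <= M) ->
  (forall x, Omega x -> Phi n x @[n --> \oo] --> u x) ->
  (forall i x, Omega x -> partial i (Phi n) x @[n --> \oo] --> g x 0 i) ->
  H10 Omega u.
Proof.
move=> tPhi PhiM dPhiM Phiu dPhig.
have mO := measurable_box lo hi; have Ofin := lebesgue_rV_box lo hi.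
have mPhi n : measurable_fun Omega (Phi n).
  by apply: measurable_funTS; apply: continuous_measurable_rV; exact: test_function_continuous (tPhi n).
have mdPhi n i : measurable_fun Omega (partial i (Phi n)).
  apply: measurable_funTS; apply: continuous_measurable_rV.
  exact: test_function_partial_continuous (tPhi n).
have mesu : measurable_fun Omega u by exact: measurable_fun_cvg mPhi Phiu.
have mg i : measurable_fun Omega (fun x => g x 0 i).
  exact: measurable_fun_cvg (fun n => mdPhi n i) (dPhig i).
have lim_le (v_ : nat -> R) (l : R) : (forall n, `|v_ n| <= M) ->
    v_ n @[n --> \oo] --> l -> `|l| <= M.
  move=> vM vl; apply: (cvgr_to_le (cvg_norm vl)).
  by apply: nearW => n; exact: vM.
have uM x : Omega x -> `|u x| <= M by move=> Ox; apply: lim_le (Phiu x Ox) => n; exact: PhiM.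
have gM i x : Omega x -> `|g x 0 i| <= M.
  by move=> Ox; apply: lim_le (dPhig i x Ox) => n; exact: dPhiM.
exists g; first split.
- exact: bounded_L2 uM.
- by move=> i; exact: bounded_L2 (gM i).
- move=> psi tpsi i.
  have [B B0 psiB] := test_function_bound tpsi.
  have [B' B'0 psiB'] := test_function_partial_bound i tpsi.
  have mpsi : measurable_fun Omega psi.
    by apply: measurable_funTS; apply: continuous_measurable_rV; exact: test_function_continuous tpsi.
  have mdpsi : measurable_fun Omega (partial i psi).
    apply: measurable_funTS; apply: continuous_measurable_rV.
    exact: test_function_partial_continuous tpsi.
  have c1 : \int[mu]_(x in Omega) (Phi n x * partial i psi x) @[n --> \oo] -->
      \int[mu]_(x in Omega) (u x * partial i psi x).
    apply: (@bounded_cvg_Rintegral _ _ _ _ _ _ _ (M * B')) => //.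
    + by move=> n; exact: measurable_funM.
    + by move=> n x _; rewrite normrM ler_pM.
    + by move=> x Ox; exact: (cvgMr_tmp (Phiu x Ox)).
  have c2 : \int[mu]_(x in Omega) (partial i (Phi n) x * psi x) @[n --> \oo] -->
      \int[mu]_(x in Omega) (g x 0 i * psi x).
    apply: (@bounded_cvg_Rintegral _ _ _ _ _ _ _ (M * B)) => //.
    + by move=> n; exact: measurable_funM.
    + by move=> n x _; rewrite normrM ler_pM.
    + by move=> x Ox; exact: (cvgMr_tmp (dPhig i x Ox)).
  have e : (fun n => \int[mu]_(x in Omega) (Phi n x * partial i psi x)) =
      (fun n => - \int[mu]_(x in Omega) (partial i (Phi n) x * psi x)).
    by apply/funext => n; exact: test_function_ibp.
  by move: c1; rewrite e => c1; exact: cvg_unique c1 (cvgN c2).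
move=> eps eps0.
pose E n := H1_dist_integrand u g (Phi n).
have mE n : measurable_fun Omega (E n) by exact: measurable_H1_dist.
have E0 n x : 0 <= E n x by exact: H1_dist_integrand_ge0.
(* Each difference in the integrand is at most [2 * M] in absolute value. *)
pose K := (2 * M) ^+ 2 + \sum_(i < d) (2 * M) ^+ 2.
have sq_le (a b : R) : `|a| <= M -> `|b| <= M -> (a - b) ^+ 2 <= (2 * M) ^+ 2.
  by rewrite !ler_norml => /andP[a1 a2] /andP[b1 b2]; nra.
have EK n x : Omega x -> `|E n x| <= K.
  move=> Ox; rewrite ger0_norm// lerD ?sq_le ?uM//.
  by apply: ler_sum => i _; rewrite sq_le ?gM.
have cE : \int[mu]_(x in Omega) E n x @[n --> \oo] --> (0 : R).
  have -> : 0 = \int[mu]_(x in Omega) (0 : R) by rewrite Rintegral_cst// mul0r.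
  apply: (@bounded_cvg_Rintegral _ _ _ _ _ _ _ K) => // x Ox.
  have sq0 (v_ : nat -> R) l : v_ n @[n --> \oo] --> l -> (l - v_ n) ^+ 2 @[n --> \oo] --> (0 : R).
    move=> vl; have vl' : l - v_ n @[n --> \oo] --> (0 : R).
      by rewrite -(subrr l); apply: cvgB vl; exact: cvg_cst.
    by rewrite -(mulr0 (0 : R)); exact: (cvgM vl' vl').
  have cS : \sum_(i < d) (g x 0 i - partial i (Phi n) x) ^+ 2 @[n --> \oo] --> (0 : R).
    rewrite [X in _ --> X](_ : 0 = \sum_(i < d) (0 : R)); last by rewrite big1_eq.
    by apply: (cvg_big add_continuous) => i _; exact: sq0 (dPhig i x Ox).
  rewrite -(addr0 (0 : R)).
  exact: cvgD (sq0 _ _ (Phiu x Ox)) cS.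
have [n En] : exists n, \int[mu]_(x in Omega) E n x < eps.
  have /cvgrPdist_lt /(_ _ eps0)[n _ /(_ n (leqnn n))] := cE.
  by rewrite /= sub0r normrN => /ltr_normlW ?; exists n.
exists (Phi n) => //; rewrite /H1_dist2.
have iE : mu.-integrable Omega (EFin \o E n).
  apply: measurable_bounded_integrable => //.
  by exists K; split=> [|N KN x Ox]; [exact: num_real|rewrite /= (le_trans (EK _ _ Ox))// ltW].
by rewrite -(fineK (integrable_fin_num mO iE)) lte_fin.
Qed.

End H10_space.

(** * Products of functions of one variable *)

Section tensor.
Context {R : realType} {d : nat}.
Implicit Types (h : 'I_d -> R -> R) (x : 'rV[R]_d).

Definition tensor h x : R := \prod_(k < d) h k (x 0 k).

Definition derive_factor (i : 'I_d) h (k : 'I_d) : R -> R :=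
  if k == i then derive1 (h k) else h k.

Lemma tensor_continuous h : (forall k, continuous (h k)) -> continuous (tensor h).
Proof.
move=> ch; apply: (continuous_big mul_continuous) => k _ x.
apply: (@continuous_comp _ _ _ (fun x : 'rV[R]_d => x 0 k) (h k)); last exact: ch.
exact: coord_continuous.
Qed.

(** Along axis [i] only the factor [h i] varies; the remaining factors form the constant [C]. *)
Lemma is_derive_tensor i h x : (forall k, smooth1 (h k)) ->
  is_derive x (delta_mx 0 i : 'rV[R]_d) (tensor h) (tensor (derive_factor i h) x).
Proof.
move=> Sh.
pose C := \prod_(k < d | k != i) h k (x 0 k).
have E t : tensor h (t *: delta_mx 0 i + x) = h i (t *: 1 + x 0 i) * C.
  rewrite /tensor (bigD1 i)//= !mxE !eqxx; congr (h i _ * _).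
  by apply: eq_bigr => k ki; rewrite !mxE (negPf ki) andbF mulr0 add0r.
have E0 : tensor h x = h i (x 0 i) * C by rewrite /tensor (bigD1 i).
have ED : tensor (derive_factor i h) x = derive1 (h i) (x 0 i) * C.
  rewrite /tensor (bigD1 i)//= /derive_factor eqxx; congr (_ * _).
  by apply: eq_bigr => k /negPf ->.
have [dh eh] := smooth1_is_derive (Sh i) (x 0 i).
have : (fun t : R => t^-1 *: (tensor h (t *: delta_mx 0 i + x) - tensor h x)) @ 0^'
    --> tensor (derive_factor i h) x.
  rewrite ED -eh.
  have -> : (fun t : R => t^-1 *: (tensor h (t *: delta_mx 0 i + x) - tensor h x)) =
      (fun t : R => (t^-1 *: (h i (t *: 1 + x 0 i) - h i (x 0 i))) * C).
    by apply/funext => t; rewrite E E0 -mulrBl scalerAl.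
  exact: cvgMr_tmp dh.
move=> cv; apply: DeriveDef; last exact: cvg_lim cv.
by apply/cvg_ex; exists (tensor (derive_factor i h) x).
Qed.

Lemma partial_tensor i h : (forall k, smooth1 (h k)) ->
  partial i (tensor h) = tensor (derive_factor i h).
Proof.
by move=> Sh; apply/funext => x; rewrite /partial; have [_ ->] := is_derive_tensor i x Sh.
Qed.

Lemma smooth1_derive_factor i h : (forall k, smooth1 (h k)) ->
  forall k, smooth1 (derive_factor i h k).
Proof.
by move=> Sh k; rewrite /derive_factor; case: ifP => _ //; exact: smooth1_derive1.
Qed.

(** Tensors of smooth factors are closed under partial derivatives, so every iterated derivative is
    one of them. *)
Lemma smooth_tensor h : (forall k, smooth1 (h k)) -> smooth (tensor h).
Proof.
move=> Sh s.
have [h' Sh' ->] : exists2 h', forall k, smooth1 (h' k) & foldr partial (tensor h) s = tensor h'.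
  elim: s => [|i s [h' Sh' /= ->]]; first by exists h.
  by exists (derive_factor i h'); [exact: smooth1_derive_factor|exact: partial_tensor].
split; first by apply: tensor_continuous => k; exact: smooth1_continuous.
by move=> i x; have [] := is_derive_tensor i x Sh'.
Qed.

Variables lo hi : 'I_d -> R.
Local Notation Omega := (box lo hi).
Local Notation mu := (lebesgue_rV d : {measure set 'rV[R]_d -> \bar R}).

Lemma interior_boxP x : Omega° x <-> forall k, lo k < x 0 k < hi k.
Proof.
split=> [|xk].
  move=> /nbhs_ballP[e /= e0 xeO] k.
  (* Moves by e/2 in both directions along axis [k] stay in the box, which makes the inequalities
     strict. *)
  have ball_upd s : `|s| < e -> Omega (s *: delta_mx 0 k + x).
    move=> se; apply: xeO; apply/coord_ballP => // j.
    rewrite !mxE eqxx/=; case: eqP => [->|_] /=; last by rewrite mulr0 add0r subrr normr0.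
    by rewrite mulr1 opprD addrCA subrr addr0 normrN.
  have e2 : `|e / 2| < e by rewrite gtr0_norm ?divr_gt0//; lra.
  have := ball_upd (e / 2) e2 k; have := ball_upd (- (e / 2)) _ k.
  rewrite normrN => /(_ e2); rewrite !mxE !eqxx/= !mulr1 => /andP[l1 _] /andP[_ h1].
  have e20 : 0 < e / 2 by rewrite divr_gt0.
  move: l1 h1 e20; move: (e / 2) (x 0 k) (lo k) (hi k) => a b l m *.
  by apply/andP; split; lra.
exists (fun _ k => `]lo k, hi k[%classic) => [i k|y /= yP k].
  by apply: open_nbhs_nbhs; split; [exact: interval_open|rewrite ord1 /= in_itv/= xk].
by have := yP 0 k; rewrite /= in_itv/= => /andP[/ltW -> /ltW ->].
Qed.

Lemma test_function_tensor h : (forall k, smooth1 (h k)) ->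
  (forall k, exists2 delta, 0 < delta &
     forall y, ~~ (lo k + delta <= y <= hi k - delta) -> h k y = 0) ->
  test_function Omega (tensor h).
Proof.
move=> Sh supp; split; first exact: smooth_tensor.
have /choice[dl dl0] : forall k, exists e, 0 < e /\
    forall y, ~~ (lo k + e <= y <= hi k - e) -> h k y = 0.
  by move=> k; have [e e0 he] := supp k; exists e.
exists [set x : 'rV[R]_d | forall k, `[lo k + dl k, hi k - dl k]%classic (x 0 k)]; split.
- apply: (@rV_compact _ _ (fun k => `[lo k + dl k, hi k - dl k]%classic)) => k.
  exact: segment_compact.
- move=> x xK; apply/interior_boxP => k; have [dk _] := dl0 k.
  have := xK k; rewrite /= in_itv/= => /andP[x1 x2].
  by rewrite (lt_le_trans _ x1) ?ltrDl// (le_lt_trans x2)// ltrBlDr ltrDl.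
- move=> x xK; have [k xk] : exists k, ~ `[lo k + dl k, hi k - dl k]%classic (x 0 k).
    exact/existsNP.
  have [_ hk] := dl0 k; rewrite /tensor (bigD1 k)//= hk ?mul0r//.
  by apply/negP => H; apply: xk; rewrite /= in_itv.
Qed.

Lemma normr_tensor_le h (C : 'I_d -> R) x : (forall k y, `|h k y| <= C k) ->
  `|tensor h x| <= \prod_(k < d) C k.
Proof. by move=> hC; rewrite normr_prod; apply: ler_prod => k _; rewrite normr_ge0 hC. Qed.

Lemma H10_tensor (f : 'I_d -> R -> R) : (forall k, lo k < hi k) ->
  (forall k, {within `[lo k, hi k], continuous (f k)}) ->
  (forall k, piecewise_polynomial (lo k) (hi k) (f k)) ->
  (forall k, f k (lo k) = 0) -> (forall k, f k (hi k) = 0) ->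
  H10 Omega (tensor f).
Proof.
move=> lohi cf pf f_lo f_hi.
have /choice[g fg] : forall k, exists g : R -> R, exists (phi : nat -> R -> R) (C : R),
  [/\ forall n, smooth1 (phi n),
      forall n, exists2 delta, 0 < delta &
        forall y, ~~ (lo k + delta <= y <= hi k - delta) -> phi n y = 0,
      forall n y, `|phi n y| <= C /\ `|derive1 (phi n) y| <= C &
      forall y, lo k <= y <= hi k ->
        phi n y @[n --> \oo] --> f k y /\
        derive1 (phi n) y @[n --> \oo] --> g y].
  move=> k; have [s fs] := pf k.
  by eexists; exact: (smooth_approx (lohi k) (cf k) fs (f_lo k) (f_hi k)).
have /choice[phi {}fg] := fg.
have /choice[C {}fg] := fg.
pose Phi n := tensor (fun k => phi k n).
pose G (x : 'rV[R]_d) : 'rV[R]_d :=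
  \row_i tensor (fun k => if k == i then g k else f k) x.
(* [C k] bounds both [phi k n] and its derivative, so one product bounds the tensors and all their
   partial derivatives. *)
apply: (@H10_bounded_limit _ _ _ _ Phi _ G (\prod_(k < d) C k)).
- move=> n; apply: test_function_tensor => k; have [Sphi supp _ _] := fg k; first exact: Sphi.
  exact: supp.
- by move=> n x; apply: normr_tensor_le => k y; have [_ _ /(_ n y)[]] := fg k.
- move=> n i x; rewrite partial_tensor; last by move=> k; have [] := fg k.
  apply: normr_tensor_le => k y; rewrite /derive_factor.
  by have [_ _ /(_ n y)[]] := fg k; case: ifP.
- move=> x Ox; apply: (cvg_big mul_continuous) => k _.
  by have [_ _ _ /(_ _ (Ox k))[]] := fg k.
- move=> i x Ox; rewrite mxE.
  have -> : (fun n => partial i (Phi n) x) =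
      (fun n => tensor (derive_factor i (fun k => phi k n)) x).
    by apply/funext => n; rewrite partial_tensor// => k; have [] := fg k.
  apply: (cvg_big mul_continuous) => k _; rewrite /derive_factor.
  by have [_ _ _ /(_ _ (Ox k))[]] := fg k; case: ifP.
Qed.

End tensor.

(** * Finite element functions *)

(** Distributivity with a range of summation that depends on the factor. The dependent choices are
    recoded as functions into a single tagged type, where the ordinary law applies. *)
Lemma prod_sum_dffun (R : comNzRingType) (d : nat) (n : 'I_d -> nat)
    (F : forall k : 'I_d, 'I_(n k) -> R) :
  \prod_(k < d) \sum_(i < n k) F k i =
  \sum_(I : {dffun forall k : 'I_d, 'I_(n k)}) \prod_(k < d) F k (I k).
Proof.
pose T (k : 'I_d) : finType := 'I_(n k).
rewrite (reindex (@dffun_of_fprod _ T)); last exact/onW_bij/dffun_of_fprod_bij.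
pose G k : {ffun T k -> R} := [ffun i => F k i].
transitivity (\sum_(f : fprod T) \prod_(k in 'I_d) G k (f k)); last first.
  by apply: eq_bigr => f _; apply: eq_bigr => k _; rewrite !ffunE.
rewrite big_fprod.
transitivity (\prod_(k < d) \sum_(j in tagged_with T k) untag 0 (G k) j); last first.
  exact: (bigA_distr_big_dep (fun k => mem (tagged_with T k)) (fun k => untag 0 (G k))).
apply: eq_bigr => k _; rewrite -(big_tag (fun k => G k)).
by apply: eq_bigr => i _; rewrite ffunE.
Qed.

Section fem.
Context {R : realType} {d : nat}.
Variables (lo hi : 'I_d -> R) (n : 'I_d -> nat) (t : forall k : 'I_d, 'I_(n k) -> R)
  (N : forall k : 'I_d, 'I_(n k) -> R -> R).
Hypothesis lo_lt_hi : forall k, lo k < hi k.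
Hypothesis t_grid : forall k, is_grid (lo k) (hi k) (@t k).
Hypothesis N_shape : forall k, is_shape_functions (lo k) (hi k) (@t k) (@N k).
Local Notation Omega := (box lo hi).
Implicit Types (u v : 'rV[R]_d -> R).

Lemma fem_space0_linear a u v : fem_space0 Omega N u -> fem_space0 Omega N v ->
  fem_space0 Omega N (fun x => a * u x + v x).
Proof.
move=> [[c uE] u0] [[c' vE] v0]; split.
  exists (fun I => a * c I + c' I) => x Ox; rewrite uE// vE// mulr_sumr -big_split/=.
  by apply: eq_bigr => I _; rewrite mulrDl mulrA.
by move=> x bx; rewrite u0// v0// mulr0 addr0.
Qed.

(** Expanding the products of sums yields FEM coefficients that are a sum of [Q] rank-one
    tensors. *)
Lemma pgd_set_fem_space Q u : pgd_set Omega N Q u -> fem_space Omega N u.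
Proof.
move=> [X [spanX uE]].
pose c q k := sval (cid (spanX q k)).
have XE q k y : X q k y = \sum_(i < n k) c q k i * N i y.
  exact: (svalP (cid (spanX q k))).
exists (fun I => \sum_(q < Q) \prod_(k < d) c q k (I k)) => x Ox; rewrite uE//.
under eq_bigr => q _ do under eq_bigr => k _ do rewrite XE.
under eq_bigr do rewrite prod_sum_dffun.
rewrite exchange_big; apply: eq_bigr => I _; rewrite mulr_suml.
by apply: eq_bigr => q _; rewrite big_split.
Qed.

Lemma pgd_set0_fem_space0 Q u : pgd_set0 Omega N Q u -> fem_space0 Omega N u.
Proof. by move=> [/pgd_set_fem_space ? ?]. Qed.

(** In the incremental case the modes are added one by one, and the FEM space is closed under
    addition. *)
Lemma pgd_solution_fem_space0 Pi Q u : pgd_solution Omega N Pi Q u ->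
  fem_space0 Omega N u.
Proof.
move=> [[/pgd_set0_fem_space0//]|[w [du [w0 wS ->]]]].
(* Only the first [Q] steps are prescribed, so the induction runs over step numbers bounded by
   [Q]. *)
have : (Q <= Q)%N by [].
elim: {-2}Q => [_|m IH mQ].
  rewrite w0; split; last by [].
  by exists (fun=> 0) => x _; rewrite big1// => I _; rewrite mul0r.
have [[/pgd_set0_fem_space0 dum _] ->] := wS m mQ.
have := fem_space0_linear 1 (IH (ltnW mQ)) dum.
by congr (fem_space0 _ _ _); apply/funext => x; rewrite mul1r.
Qed.

Definition node (I : {dffun forall k : 'I_d, 'I_(n k)}) : 'rV[R]_d := \row_k t (I k).

Lemma node_box I : Omega (node I).
Proof. by move=> k; rewrite mxE; exact: grid_bounds (t_grid k) _. Qed.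

Lemma fem_coef u (c : {dffun forall k : 'I_d, 'I_(n k)} -> R) I :
  (forall x, Omega x -> u x = \sum_I c I * \prod_(k < d) N (I k) (x 0 k)) ->
  u (node I) = c I.
Proof.
move=> uE; rewrite uE; last exact: node_box.
rewrite (bigD1 I)//= [X in _ + X]big1 ?addr0 => [|J JI].
  rewrite big1 ?mulr1// => k _; rewrite mxE (shape_node (N_shape k)) eqxx//.
have [k JIk] : exists k, J k != I k.
  apply/existsP; rewrite -negb_forall; apply: contra JI => /forallP JI.
  by apply/eqP/ffunP => k; exact/eqP/JI.
by rewrite (bigD1 k)//= mxE (shape_node (N_shape k)) (negPf JIk) mul0r mulr0.
Qed.

Lemma node_boundary (I : {dffun forall k : 'I_d, 'I_(n k)}) k :
  t (I k) = lo k \/ t (I k) = hi k -> boundary Omega (node I).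
Proof.
move=> Ik; split; first exact/subset_closure/node_box.
move=> /interior_boxP/(_ k); rewrite mxE.
by case: Ik => ->; rewrite ltxx ?andbF.
Qed.

Lemma H10_0 : (0 < d)%N -> H10 Omega (fun=> 0).
Proof.
move=> d0; apply: (@H10_ext _ _ lo hi (tensor (fun _ _ => 0))) => [x _|].
  (* A tensor of zero factors is 0 only in positive dimension, the empty product being 1. *)
  by rewrite /tensor (bigD1 (Ordinal d0))//= mul0r.
apply: H10_tensor => // k.
  by apply: continuous_subspaceT => x; exact: cvg_cst.
by exists [::] => *; exists 0 => x _; rewrite horner0.
Qed.

(** The alternative [c i = 0] takes care of the shape functions of boundary nodes, which need not
    vanish on the boundary. *)
Lemma H10_sum (I : Type) (r : seq I) (c : I -> R) (F : I -> 'rV[R]_d -> R) : (0 < d)%N ->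
  (forall i, c i = 0 \/ H10 Omega (F i)) ->
  H10 Omega (fun x => \sum_(i <- r) c i * F i x).
Proof.
move=> d0 cF; elim: r => [|i r IH].
  by under eq_fun do rewrite big_nil; exact: H10_0.
under eq_fun do rewrite big_cons.
have [c0|Fi] := cF i; last exact: H10_linear.
by under eq_fun do rewrite c0 mul0r add0r.
Qed.

Lemma fem_space0_H10 u : (0 < d)%N -> fem_space0 Omega N u -> H10 Omega u.
Proof.
move=> d0 [[c uE] u0].
apply: (@H10_ext _ _ lo hi (fun x => \sum_I c I * tensor (fun k => N (I k)) x)).
  by move=> x Ox; rewrite uE.
apply: H10_sum => // I.
have [[k Ik]|Iint] := pselect (exists k, t (I k) = lo k \/ t (I k) = hi k).
  by left; rewrite -(fem_coef I uE) u0//; exact: node_boundary Ik.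
right; apply: H10_tensor => // k.
- exact: shape_continuous (N_shape k) _.
- exact: shape_piecewise (N_shape k) _.
(* The end point is itself a grid node, different from the one of [I k], so the shape function is 0
   there. *)
- have [j tj] := grid_lo (t_grid k); rewrite -tj (shape_node (N_shape k)).
  by case: eqP => // Ij; exfalso; apply: Iint; exists k; left; rewrite Ij.
- have [j tj] := grid_hi (t_grid k); rewrite -tj (shape_node (N_shape k)).
  by case: eqP => // Ij; exfalso; apply: Iint; exists k; right; rewrite Ij.
Qed.

End fem.

(** * The energy *)

(** For small [s] of sign opposite to [al] the linear term would outweigh the quadratic one;
    [s = - al / (|be| + 1)] is small enough. *)
Lemma linear_part_eq0 (R : realFieldType) (al be : R) :
  (forall s, 0 <= s * al + s ^+ 2 * be) -> al = 0.
Proof.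
move=> H; apply/eqP; rewrite -sqrf_eq0; apply/eqP/le_anti; rewrite sqr_ge0 andbT.
have b0 : 0 < `|be| + 1 by rewrite ltr_wpDl.
pose D := `|be| + 1; pose q := al ^+ 2 / D; pose r := be / D.
have r1 : r < 1 by rewrite /r ltr_pdivrMr// mul1r (le_lt_trans (ler_norm _))// ltrDl.
have -> : al ^+ 2 = q * D by rewrite /q divfK// gt_eqF.
have := H (- (al / D)).
have -> : - (al / D) * al + (- (al / D)) ^+ 2 * be = q * (r - 1).
  by rewrite /q /r; field; rewrite gt_eqF.
move=> qr; rewrite pmulr_lle0// leNgt; apply/negP => q0.
by move: qr; rewrite leNgt pmulr_rlt0// subr_lt0 r1.
Qed.

Section energy.
Context {R : realType} {d : nat}.
Variables (lo hi : 'I_d -> R).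
Local Notation Omega := (box lo hi).
Local Notation mu := (lebesgue_rV d : {measure set 'rV[R]_d -> \bar R}).
Variables (A : 'rV[R]_d -> 'M[R]_d) (B : 'rV[R]_d -> 'rV[R]_d) (c : 'rV[R]_d -> R).
Variable a : ('rV[R]_d -> R) -> ('rV[R]_d -> R) -> R.
Hypothesis a_spd : symmetric_positive_form Omega a.
Hypothesis a_operator : form_of_operator Omega A B c a.
Variable b : 'rV[R]_d -> R.
Hypothesis b_source : is_source Omega b.
Implicit Types (u v w : 'rV[R]_d -> R).

Lemma ae0_Rintegral (f : 'rV[R]_d -> R) : measurable_fun Omega f ->
  {ae mu, forall x, Omega x -> f x = 0} -> \int[mu]_(x in Omega) f x = 0.
Proof.
move=> mf f0; rewrite /Rintegral.
have -> : (\int[mu]_(x in Omega) (f x)%:E = \int[mu]_(x in Omega) cst 0 x)%E.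
  apply: ae_eq_integral => //; [exact: measurable_box|exact/measurable_EFinP|].
  by apply: filterS f0 => x /= fx /fx ->.
by rewrite integral0.
Qed.

(* form_pos says nothing about u = 0 a.e.; such a u has weak gradient 0, so that
   a(u, u) = 0 by the integral formula for a. *)
Lemma form_ge0 u : H10 Omega u -> 0 <= a u u.
Proof.
move=> Hu; have [u0|u0] := pselect (Defs.ae_eq0 Omega u); last exact/ltW/(form_pos a_spd).
have [g [Lu Lg wu] _] := Hu.
have L0 : L2 Omega (fun=> 0 : R) by apply: (@bounded_L2 _ _ _ _ _ 0) => // x _; rewrite normr0.
have H1u : H1 Omega u (fun=> 0).
  split => // [i|phi tphi i].
    by under eq_fun do rewrite mxE.
  under [in RHS]eq_Rintegral do rewrite mxE mul0r.
  rewrite Rintegral_cst ?mul0r ?oppr0; last exact: measurable_box.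
  apply: ae0_Rintegral; last by apply: filterS u0 => x /[apply] ->; rewrite mul0r.
  apply: measurable_funM; first by case: Lu.
  apply: measurable_funTS; apply: continuous_measurable_rV.
  exact: test_function_partial_continuous tphi.
have [iW ->] := a_operator Hu H1u Hu H1u.
rewrite ae0_Rintegral//; first by have /integrableP[/measurable_EFinP] := iW.
apply: filterS u0 => x u0 Ox; rewrite /weak_form_integrand u0// mulr0 subr0 big1 ?big1 ?subr0//.
  by move=> i _; rewrite mulr0.
by move=> i _; rewrite big1// => j _; rewrite !mxE mulr0.
Qed.

Lemma form_expand s u v : H10 Omega u -> H10 Omega v ->
  a (fun x => s * v x + u x) (fun x => s * v x + u x) =
  a u u + 2 * s * a u v + s ^+ 2 * a v v.
Proof.
move=> Hu Hv; have Hw := H10_linear s Hv Hu.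
rewrite (form_linear a_spd)// (form_sym a_spd Hv Hw) (form_sym a_spd Hu Hw).
by rewrite !(form_linear a_spd)// (form_sym a_spd Hv Hu); ring.
Qed.

(** The Euler-Lagrange equation in weak form, for any linear subspace of H^1_0, so that it covers
    both the FEM space and H^1_0 itself. *)
Lemma argmin_energy (S : set ('rV[R]_d -> R)) u :
  (forall v, S v -> H10 Omega v) ->
  (forall s v w, S v -> S w -> S (fun x => s * v x + w x)) ->
  is_argmin S (energy Omega a b) u ->
  forall v, S v -> a u v = \int[mu]_(x in Omega) (b x * v x).
Proof.
move=> SH Slin [Su umin] v Sv.
have Hu := SH _ Su; have Hv := SH _ Sv; have mO := measurable_box lo hi.
apply/eqP; rewrite -subr_eq0; apply/eqP.
(* u + s v is a competitor for every s. *)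
apply: (@linear_part_eq0 _ _ (a v v / 2)) => s.
have := umin _ (Slin s _ _ Sv Su).
rewrite /energy form_expand//.
have -> : \int[mu]_(x in Omega) (b x * (s * v x + u x)) =
    s * \int[mu]_(x in Omega) (b x * v x) + \int[mu]_(x in Omega) (b x * u x).
  rewrite -RintegralZl//; last exact: b_source Hv.
  rewrite -RintegralD//; last 2 first.
  - exact: (integrableZl mO s (b_source Hv)).
  - exact: b_source Hu.
  by apply: eq_Rintegral => x _; ring.
move: (a u u) (a u v) (a v v) (\int[mu]_(x in Omega) (b x * v x)) => p q r y.
by move: (\int[mu]_(x in Omega) (b x * u x)) => z H; lra.
Qed.

End energy.

(** * Galerkin orthogonality and the Pythagorean identity *)

Theorem theorem1 (R : realType) (d : nat) (hd : d = 2%N \/ d = 3%N)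
  (lo hi : 'I_d -> R) (lo_lt_hi : forall k, lo k < hi k)
  (A : 'rV[R]_d -> 'M[R]_d) (B : 'rV[R]_d -> 'rV[R]_d) (c : 'rV[R]_d -> R)
  (a : ('rV[R]_d -> R) -> ('rV[R]_d -> R) -> R)
  (a_spd : symmetric_positive_form (box lo hi) a)
  (a_operator : form_of_operator (box lo hi) A B c a)
  (b : 'rV[R]_d -> R)
  (b_source : is_source (box lo hi) b)
  (n : 'I_d -> nat) (t : forall k : 'I_d, 'I_(n k) -> R)
  (t_grid : forall k, is_grid (lo k) (hi k) (t k))
  (N : forall k : 'I_d, 'I_(n k) -> R -> R)
  (N_shape : forall k, is_shape_functions (lo k) (hi k) (t k) (N k))
  (Q : nat) (Q_ge1 : (1 <= Q)%N)
  (u_exact u_fem u_pgd : 'rV[R]_d -> R)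
  (exactP : is_argmin (H10 (box lo hi)) (energy (box lo hi) a b) u_exact)
  (femP : fem_solution (box lo hi) N (energy (box lo hi) a b) u_fem)
  (pgdP : pgd_solution (box lo hi) N (energy (box lo hi) a b) Q u_pgd) :
  energy_norm a (u_pgd \- u_exact) ^+ 2 =
  energy_norm a (u_fem \- u_exact) ^+ 2 + energy_norm a (u_pgd \- u_fem) ^+ 2.
Proof.
have d0 : (0 < d)%N by case: hd => ->.
pose V0 := fem_space0 (box lo hi) N.
have V0H u : V0 u -> H10 (box lo hi) u by exact: fem_space0_H10.
have pgd_V0 : V0 u_pgd by exact: pgd_solution_fem_space0 pgdP.
have fem_V0 : V0 u_fem by have [] := femP.
have Hexact : H10 (box lo hi) u_exact by have [] := exactP.
(* The differences are written as [k * f + g], the shape in which closure and linearity are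
   stated. *)
pose v := fun x => -1 * u_fem x + u_pgd x.
pose w := fun x => -1 * u_exact x + u_fem x.
have V0v : V0 v by exact: fem_space0_linear.
have Hv := V0H _ V0v.
have Hfem := V0H _ fem_V0.
have Hw : H10 (box lo hi) w by exact: H10_linear.
(* Galerkin orthogonality: both minimizers are tested against the same [v], and the two source terms
   cancel. *)
have awv : a w v = 0.
  have Efem := argmin_energy a_spd b_source V0H (@fem_space0_linear _ _ lo hi n N) femP V0v.
  have Eex := argmin_energy a_spd b_source (fun _ => id) (@H10_linear _ _ lo hi) exactP Hv.
  by rewrite (form_linear a_spd)// Efem Eex mulN1r addNr.
have -> : u_pgd \- u_exact = fun x => 1 * v x + w x.
  by apply/funext => x; rewrite /v /w /=; ring.
have -> : u_fem \- u_exact = w by apply/funext => x; rewrite /w /=; ring.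
have -> : u_pgd \- u_fem = v by apply/funext => x; rewrite /v /=; ring.
have Hvw := H10_linear 1 Hv Hw.
(* The square undoes the square root only for nonnegative arguments, whence the recourse to
   [form_ge0]. *)
rewrite /energy_norm !sqr_sqrtr ?(form_ge0 a_spd a_operator)//.
by rewrite (form_expand a_spd)// awv; ring.
Qed.
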